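(* Let $m$ be a positive integer. Then $$\sum_{k=0}^m2^{-2k}\,\zeta(2k)\,\lambda(2m-2k+2)=0.$$
   Context: The Dirichlet lambda function is $\lambda(s)=\sum_{n=0}^\infty\frac{1}{(2n+1)^s}$ for $\mathrm{Re}(s)>1$. Here $\zeta$ is the Riemann zeta function, $\zeta(s)=\sum_{n=1}^\infty n^{-s}$ for $\mathrm{Re}(s)>1$, extended by analytic continuation (so that $\zeta(0)=-\frac12$). *)

(* Defs.v *)
From Stdlib Require Import Reals.
From Coquelicot Require Import Coquelicot.

Local Open Scope C_scope.

Definition Cexp (z : C) : C :=
  ((exp (Re z) * cos (Im z))%R, (exp (Re z) * sin (Im z))%R).

(** [Rcpow x s] is x^s; it is only meaningful for x > 0, since [ln x] is 0
    for x <= 0. *)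
Definition Rcpow (x : R) (s : C) : C := Cexp (s * RtoC (ln x)).

(** Sum of a complex series, meaningful only when the series converges. *)
Definition CSeries (a : nat -> C) : C :=
  (Series (fun n => Re (a n)), Series (fun n => Im (a n))).

Definition analytic_at (f : C -> C) (z0 : C) : Prop :=
  exists (a : nat -> C) (r : R), (0 < r)%R /\
    forall z : C, (Cmod (z - z0) < r)%R ->
      @is_pseries C_AbsRing C_NormedModule a (z - z0) (f z).

(** Since C \ {1} is connected, these two conditions determine [zeta] uniquely
    on C \ {1}; the value at the pole 1 is left arbitrary. *)
Definition is_riemann_zeta (zeta : C -> C) : Prop :=
  (forall s : C, (1 < Re s)%R ->
     @is_series C_AbsRing C_NormedModule
       (fun n : nat => Rcpow (INR (S n)) (- s)) (zeta s)) /\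
  (forall s : C, s <> RtoC 1 -> analytic_at zeta s).

(** The Dirichlet lambda function, on its half-plane of convergence Re s > 1. *)
Definition dirichlet_lambda (s : C) : C :=
  CSeries (fun n : nat => / Rcpow (2 * INR n + 1) s).

(* Main.v *)
Require Import Defs.
From Stdlib Require Import Reals Factorial ZArith Lra Lia.
From Coquelicot Require Import Coquelicot.

(** The identity is the partial-fraction shadow of [cot * tan = 1].  Write
    [e] for a positive even integer and [o] for a positive odd one.  Since
    [2^(-2k) zeta(2k)] is the sum of [e^(-2k)] and [lambda(2j)] is the sum of
    [o^(-2j)], a finite geometric sum over [k = 1, ..., m] turns the terms
    with [k >= 1] into the double sum of

      [(e^(-2m) - o^(-2m)) / (o^2 - e^2)].

    For fixed [e] the sum of [1 / (o^2 - e^2)] over [o] vanishes, and for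
    fixed [o] the sum over [e] is [- 1 / (2 o^2)]; both telescope once
    [1 / (o^2 - e^2)] is split into simple fractions
    ([pole_row_sum], [pole_column_sum]).  The double sum is therefore
    [lambda(2m+2) / 2] ([even_odd_convolution]).  The interchange of the two
    sums is carried out on square truncations, whose errors are controlled by
    the explicit remainders of the telescoped sums and dominated convergence
    ([is_lim_seq_weighted_sum]).

    The term [k = 0] is [zeta(0) lambda(2m+2)], so what remains is
    [zeta(0) = -1/2] ([zeta_at_0]) for a function known only through its
    Dirichlet series on [Re s > 1] and through being locally a power series
    off [1].  The Euler-Maclaurin formula gives, for [s > 1],

      [(s-1) (zeta(s) - 1/2) - 1 = sum over n of T_n(s)],

    where [T_n(s)] is the error of the trapezoid rule for the integral of
    [(s-1) x^(-s)] over [[n+1, n+2]].  Each [T_n] is entire, and its Taylor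
    coefficients at [s = 2] are the trapezoid errors of the Taylor
    coefficients of the integrand; bounding these by a second derivative in
    [x] shows that the series can be rearranged into one power series in
    [s - 2] that converges for [|s - 2| <= 5/2]
    ([trapezoid_pseries]).  The difference of the two sides is
    then analytic on a disc around [2] that contains [0], except at [1], and
    it vanishes near [2] on the real axis.  By isolation of zeros the
    vanishing spreads from a point just above [2] down the straight segment
    to [0], which avoids [1] ([analytic_zero_along_segment]).
    Finally [T_n(0) = 0], because the trapezoid rule is exact for constants,
    and this leaves [- (zeta(0) - 1/2) - 1 = 0]. *)

Local Open Scope R_scope.

(** * Real sums and series *)

(** Equalities between values of [sum_n] live in the carrier of an algebraic
    structure on [R]; [ring] and [field] recognise them only at type [R]. *)
Ltac eq_in_R := match goal with |- @eq _ ?a ?b => change (@eq R a b) end.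

Lemma sum_n_RS (a : nat -> R) (n : nat) : sum_n a (S n) = sum_n a n + a (S n).
Proof. exact (sum_Sn a n). Qed.

Lemma sum_n_R0 (a : nat -> R) : sum_n a 0 = a 0%nat.
Proof. exact (sum_O a). Qed.

Lemma sum_n_Rscal (c : R) (a : nat -> R) (n : nat) :
  sum_n (fun k => c * a k) n = c * sum_n a n.
Proof. exact (sum_n_mult_l (K := R_Ring) c a n). Qed.

Lemma is_series_Rext (a b : nat -> R) (l : R) :
  (forall n, a n = b n) -> is_series a l -> is_series b l.
Proof. exact (@is_series_ext R_AbsRing R_NormedModule a b l). Qed.

Lemma is_series_Rconv (a b : nat -> R) (l l' : R) :
  (forall n, a n = b n) -> l = l' -> is_series a l -> is_series b l'.
Proof. intros Hab <-. now apply is_series_Rext. Qed.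

Lemma is_series_Rplus (a b : nat -> R) (la lb : R) :
  is_series a la -> is_series b lb -> is_series (fun n => a n + b n) (la + lb).
Proof. exact (@is_series_plus R_AbsRing R_NormedModule a b la lb). Qed.

Lemma is_series_Rscal (c : R) (a : nat -> R) (l : R) :
  is_series a l -> is_series (fun n => c * a n) (c * l).
Proof. exact (@is_series_scal_l R_AbsRing R_NormedModule c a l). Qed.

(** * Interchange of double series *)

Lemma is_series_norm_le {K : AbsRing} {V : NormedModule K}
    (a : nat -> V) (b : nat -> R) (la : V) (lb : R) :
  (forall n, norm (a n) <= b n) -> is_series a la -> is_series b lb ->
  norm la <= lb.
Proof.
  intros Hab Ha Hb.
  change (Rbar_le (norm la) lb).
  refine (@filterlim_le nat eventually _ (fun N => norm (sum_n a N)) (sum_n b)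
            (norm la) lb _ _ _).
  - exists 0%nat. intros N _. unfold sum_n.
    eapply Rle_trans; [apply norm_sum_n_m | now apply sum_n_m_le].
  - exact (filterlim_comp _ _ _ _ _ _ _ _ Ha (filterlim_norm la)).
  - exact Hb.
Qed.

Lemma ex_series_bounded_sums (a : nat -> R) (M : R) :
  (forall n, 0 <= a n) -> (forall N, sum_n a N <= M) -> ex_series a.
Proof.
  intros Ha HM.
  destruct (ex_finite_lim_seq_incr (sum_n a) M) as [l Hl].
  - intros n. rewrite sum_Sn. specialize (Ha (S n)). unfold plus; simpl. lra.
  - exact HM.
  - exists l. exact Hl.
Qed.

Lemma sum_n_nonneg_le_series (a : nat -> R) (l : R) :
  (forall n, 0 <= a n) -> is_series a l -> forall N, sum_n a N <= l.
Proof.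
  intros Ha Hl N.
  apply (is_lim_seq_incr_compare (sum_n a) l Hl).
  intros n. rewrite sum_Sn. specialize (Ha (S n)). unfold plus; simpl. lra.
Qed.

Lemma is_series_sum_n {K : AbsRing} {V : NormedModule K}
    (u : nat -> nat -> V) (a : nat -> V) :
  (forall k, is_series (fun n => u n k) (a k)) ->
  forall N, is_series (fun n => sum_n (u n) N) (sum_n a N).
Proof.
  intros H N; induction N as [|N IH].
  - rewrite sum_O. apply is_series_ext with (2 := H 0%nat).
    intros n; now rewrite sum_O.
  - rewrite sum_Sn.
    apply is_series_ext with (2 := is_series_plus _ _ _ _ IH (H (S N))).
    intros n; now rewrite sum_Sn.
Qed.

Lemma filterlim_zero_norm {T : Type} {K : AbsRing} {V : NormedModule K}
    {F : (T -> Prop) -> Prop} {FF : Filter F} (f : T -> V) :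
  filterlim f F (locally (zero : V)) <->
  forall eps : posreal, F (fun x => norm (f x) < eps).
Proof.
  rewrite (filterlim_locally_ball_norm f (zero : V)).
  split; intros H eps; generalize (H eps); apply filter_imp;
    intros x Hx; unfold ball_norm in *.
  - rewrite <- (minus_zero_r (f x)). exact Hx.
  - rewrite <- (minus_zero_r (f x)) in Hx. exact Hx.
Qed.

Lemma is_series_minus_norm {K : AbsRing} {V : NormedModule K}
    (a : nat -> V) (l : V) :
  is_series a l <->
  filterlim (fun N => minus l (sum_n a N)) eventually (locally (zero : V)).
Proof.
  split; intros H.
  - apply filterlim_zero_norm; intros eps.
    generalize (proj1 (filterlim_locally_ball_norm (sum_n a) l) H eps).
    apply filter_imp; intros N HN. unfold ball_norm in HN.
    now rewrite <- norm_opp, opp_minus.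
  - apply filterlim_locally_ball_norm; intros eps.
    generalize (proj1 (filterlim_zero_norm _) H eps).
    apply filter_imp; intros N HN. unfold ball_norm.
    now rewrite <- norm_opp, opp_minus.
Qed.

Lemma filterlim_sum_n_zero {K : AbsRing} {V : NormedModule K}
    (v : nat -> nat -> V) :
  (forall n, filterlim (v n) eventually (locally (zero : V))) ->
  forall N, filterlim (fun j => sum_n (fun n => v n j) N) eventually
              (locally (zero : V)).
Proof.
  intros H N; induction N as [|N IH].
  - apply filterlim_ext with (2 := H 0%nat). intros j; now rewrite sum_O.
  - apply filterlim_ext with
      (fun j => plus (sum_n (fun n => v n j) N) (v (S N) j)).
    { intros j; now rewrite sum_Sn. }
    replace (zero : V) with (plus (zero : V) zero) by apply plus_zero_l.
    apply filterlim_comp_2 with (1 := IH) (2 := H (S N)).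
    apply @filterlim_plus.
Qed.

Lemma plus_minus_cancel {G : AbelianGroup} (x y : G) :
  plus (minus x y) y = x.
Proof.
  unfold minus. now rewrite <- plus_assoc, plus_opp_l, plus_zero_r.
Qed.

Lemma norm_minus_le {K : AbsRing} {V : NormedModule K} (x y : V) :
  norm (minus x y) <= norm x + norm y.
Proof.
  unfold minus. rewrite <- (norm_opp y). apply @norm_triangle.
Qed.

(** Dominated convergence for series: beyond an index [N] the sum is at most a
    tail of [B], uniformly in [j], and below it only finitely many terms have
    to tend to zero. *)
Lemma tannery_zero {K : AbsRing} {V : NormedModule K}
    (v : nat -> nat -> V) (B : nat -> R) (t : nat -> V) :
  (forall n j, norm (v n j) <= B n) -> ex_series B ->
  (forall n, filterlim (v n) eventually (locally (zero : V))) ->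
  (forall j, is_series (fun n => v n j) (t j)) ->
  filterlim t eventually (locally (zero : V)).
Proof.
  intros HB [lB HlB] Hv Ht.
  apply filterlim_zero_norm; intros eps.
  assert (HB0 : forall n, 0 <= B n).
  { intros n. apply Rle_trans with (norm (v n 0%nat)); [apply norm_ge_0 | apply HB]. }
  pose (e2 := mkposreal (eps / 2) (is_pos_div_2 eps)).
  destruct (proj1 (filterlim_locally_ball_norm (sum_n B) lB) HlB e2) as [N HN].
  specialize (HN N (Nat.le_refl _)).
  unfold ball_norm in HN. change (Rabs (sum_n B N - lB) < eps / 2) in HN.
  apply Rabs_def2 in HN.
  destruct (proj1 (filterlim_zero_norm _)
              (filterlim_sum_n_zero v Hv N) e2) as [J HJ].
  exists J. intros j Hj. specialize (HJ j Hj).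
  simpl in HJ.
  assert (Htail : norm (minus (t j) (sum_n (fun n => v n j) N))
                  <= lB - sum_n B N).
  { apply (is_series_norm_le (fun n => v (S N + n)%nat j)
             (fun n => B (S N + n)%nat)).
    - intros n; apply HB.
    - apply (is_series_incr_n (fun n => v n j)); [lia|]. simpl Init.Nat.pred.
      exact (eq_ind_r (is_series (fun n => v n j)) (Ht j)
               (plus_minus_cancel _ _)).
    - apply (is_series_incr_n B); [lia|]. simpl Init.Nat.pred.
      exact (eq_ind_r (is_series B) HlB
               (plus_minus_cancel (G := R_AbelianGroup) _ _)). }
  replace (t j) with
    (plus (minus (t j) (sum_n (fun n => v n j) N)) (sum_n (fun n => v n j) N)).
  2: apply plus_minus_cancel.
  eapply Rle_lt_trans; [apply norm_triangle|]. lra.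
Qed.

(** Fubini for a double series whose rows are absolutely bounded by a summable
    sequence.  The difference between the sum of the row sums and the first
    [j] column sums is the series of the row remainders, to which
    [tannery_zero] applies.  The column sums are produced by the lemma, and
    their absolute convergence is what later makes them coefficients of a
    power series. *)
Lemma series_exchange {K : AbsRing} {V : CompleteNormedModule K}
    (u : nat -> nat -> V) (B : nat -> R) (s : nat -> V) :
  (forall n N, sum_n (fun k => norm (u n k)) N <= B n) -> ex_series B ->
  (forall n, is_series (u n) (s n)) ->
  exists (a : nat -> V) (S : V),
    (forall k, is_series (fun n => u n k) (a k)) /\
    ex_series (fun k => norm (a k)) /\ is_series s S /\ is_series a S.
Proof.
  intros HB HexB Hs.
  assert (Hterm : forall n k, norm (u n k) <= B n).
  { intros n k. eapply Rle_trans; [|apply (HB n k)].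
    destruct k as [|k]; [rewrite sum_O; lra|].
    rewrite sum_Sn. unfold plus; simpl.
    assert (0 <= sum_n (fun k => norm (u n k)) k); [|lra].
    eapply Rle_trans; [exact (norm_ge_0 (sum_n (u n) k))|].
    apply (norm_sum_n_m (u n)). }
  assert (Hpart : forall n N, norm (sum_n (u n) N) <= B n).
  { intros n N. eapply Rle_trans; [apply (norm_sum_n_m (u n)) | apply HB]. }
  assert (HsB : forall n, norm (s n) <= B n).
  { intros n.
    refine (@filterlim_le nat eventually _ (fun N => norm (sum_n (u n) N))
              (fun _ => B n) (norm (s n)) (B n) _ _ _).
    - exists 0%nat. intros N _. apply Hpart.
    - exact (filterlim_comp _ _ _ _ _ _ _ _ (Hs n) (filterlim_norm (s n))).
    - apply filterlim_const. }
  pose (a := fun k => iota (fun x : V => is_series (fun n => u n k) x)).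
  assert (Ha : forall k, is_series (fun n => u n k) (a k)).
  { intros k.
    destruct (ex_series_le (fun n => u n k) B) as [x Hx];
      [intros n; apply Hterm | exact HexB |].
    replace (a k) with x; [exact Hx|]. symmetry.
    exact (iota_filterlim_locally (sum_n (fun n => u n k)) x Hx). }
  destruct (ex_series_le s B HsB HexB) as [S HS].
  exists a, S. split; [exact Ha|]. split; [|split; [exact HS|]].
  - destruct HexB as [lB HlB].
    apply ex_series_bounded_sums with lB; [intros; apply norm_ge_0|].
    assert (Hn : forall k, ex_series (fun n => norm (u n k))).
    { intros k. apply (ex_series_le (K := R_AbsRing) (V := R_CompleteNormedModule)
                         (fun n => norm (u n k)) B).
      - intros n. unfold norm at 1; simpl. unfold abs; simpl.
        rewrite Rabs_pos_eq by apply norm_ge_0. apply Hterm.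
      - now exists lB. }
    pose (c := fun k => Series (fun n => norm (u n k))).
    assert (Hc : forall k, is_series (fun n => norm (u n k)) (c k)).
    { intros k. apply Series_correct, Hn. }
    intros N. apply Rle_trans with (sum_n c N).
    + apply sum_n_m_le. intros k.
      apply (is_series_norm_le _ _ _ _ (fun n => Rle_refl _) (Ha k) (Hc k)).
    + assert (H := is_series_sum_n (fun n k => norm (u n k)) c Hc N).
      eapply Rle_trans; [apply Rle_abs|].
      apply (is_series_norm_le (K := R_AbsRing) (V := R_NormedModule)
               _ B _ _) with (2 := H) (3 := HlB).
      intros n. unfold norm at 1; simpl. unfold abs; simpl.
      rewrite Rabs_pos_eq; [apply HB|].
      eapply Rle_trans; [exact (norm_ge_0 (sum_n (u n) N))|].
      apply (norm_sum_n_m (u n)).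
  - apply is_series_minus_norm.
    apply (tannery_zero (fun n j => minus (s n) (sum_n (u n) j))
             (fun n => 2 * B n)).
    + intros n j.
      refine (Rle_trans _ _ _ (norm_minus_le (s n) (sum_n (u n) j)) _).
      specialize (HsB n). specialize (Hpart n j). lra.
    + apply (ex_series_scal_l (K := R_AbsRing) 2 B HexB).
    + intros n. apply (is_series_minus_norm (u n) (s n)), Hs.
    + intros j.
      exact (is_series_minus s (fun n => sum_n (u n) j) S _ HS
               (is_series_sum_n u a Ha j)).
Qed.

(** * Complex series *)

Lemma is_series_RtoC (a : nat -> R) (l : R) : is_series a l ->
  @is_series C_AbsRing C_NormedModule (fun n => RtoC (a n)) (RtoC l).
Proof.
  intros H.
  apply (filterlim_ext (fun N => RtoC (sum_n a N))).
  - intros N. induction N as [|N IH]; [now rewrite !sum_O|].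
    rewrite !sum_Sn, <- IH. apply RtoC_plus.
  - apply (filterlim_comp _ _ _ _ RtoC _ (locally l) _ H).
    intros P [eps HP]. exists eps. intros y Hy. apply HP.
    split; [exact Hy | apply ball_center].
Qed.

Lemma is_series_C_pair (u : nat -> C) (l : C) :
  @is_series C_AbsRing C_NormedModule u l ->
  is_series (fun n => Re (u n)) (Re l) /\ is_series (fun n => Im (u n)) (Im l).
Proof.
  intros H.
  assert (E : forall N,
    Re (sum_n (G := C_AbelianMonoid) u N) = sum_n (fun n => Re (u n)) N /\
    Im (sum_n (G := C_AbelianMonoid) u N) = sum_n (fun n => Im (u n)) N).
  { intros N. induction N as [|N [IH1 IH2]]; [now rewrite !sum_O|].
    rewrite !sum_Sn, <- IH1, <- IH2. split; reflexivity. }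
  split.
  - apply (filterlim_ext (fun N => fst (sum_n (G := C_AbelianMonoid) u N)));
      [apply E|].
    apply (filterlim_comp _ _ _ _ fst _ (locally l) _ H).
    intros P [eps HP]. exists eps. intros z [Hz _]. exact (HP _ Hz).
  - apply (filterlim_ext (fun N => snd (sum_n (G := C_AbelianMonoid) u N)));
      [apply E|].
    apply (filterlim_comp _ _ _ _ snd _ (locally l) _ H).
    intros P [eps HP]. exists eps. intros z [_ Hz]. exact (HP _ Hz).
Qed.

(** Convergence in [C] makes both component series converge, so the
    componentwise sum is the sum. *)
Lemma CSeries_unique (u : nat -> C) (l : C) :
  @is_series C_AbsRing C_NormedModule u l -> CSeries u = l.
Proof.
  intros H. destruct (is_series_C_pair u l H) as [H1 H2].
  unfold CSeries. rewrite (is_series_unique _ _ H1), (is_series_unique _ _ H2).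
  now destruct l.
Qed.

Lemma pow_n_Cpow (z : C) (n : nat) : pow_n (K := C_Ring) z n = (z ^ n)%C.
Proof.
  induction n as [|n IH]; simpl; [reflexivity|].
  now rewrite IH.
Qed.

Lemma is_pseries_C (a : nat -> C) (z l : C) :
  @is_pseries C_AbsRing C_NormedModule a z l <->
  @is_series C_AbsRing C_NormedModule (fun k => a k * z ^ k)%C l.
Proof.
  assert (E : forall n, scal (pow_n (K := C_Ring) z n) (a n : C_NormedModule)
                        = (a n * z ^ n)%C).
  { intros n. change ((pow_n (K := C_Ring) z n * a n = a n * z ^ n)%C).
    rewrite pow_n_Cpow. apply Cmult_comm. }
  split; apply (@is_series_ext C_AbsRing C_NormedModule); intros n;
    [apply E | symmetry; apply E].
Qed.

(** * Isolated zeros and propagation along a segment *)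

(** Convergence of the power series at the points [h] is part of the
    condition, so no radius of convergence has to be carried along. *)
Definition zeros_cluster (a : nat -> C) : Prop :=
  forall delta : R, 0 < delta ->
    exists h : C, 0 < Cmod h < delta /\
      @is_pseries C_AbsRing C_NormedModule a h (RtoC 0).

(** Convergence at one zero [h0] bounds [a k] by [M / |h0|^k].  At a zero [h]
    with [q = |h| / |h0|], the constant coefficient is minus the sum of the
    other terms, hence at most [M q / (1 - q)], which is arbitrarily small. *)
Lemma zeros_cluster_coef0 (a : nat -> C) :
  zeros_cluster a -> a 0%nat = RtoC 0.
Proof.
  intros Ha.
  destruct (Ha 1 Rlt_0_1) as (h0 & [Hh0 _] & Hs0).
  apply is_pseries_C in Hs0.
  destruct (@filterlim_bounded C_AbsRing C_NormedModule
              (sum_n (G := C_AbelianMonoid) (fun k => a k * h0 ^ k)%C))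
    as [M0 HM0]; [now exists (RtoC 0)|].
  (* Each term is a partial sum or a difference of two, and M0 bounds them all. *)
  assert (HM : forall k, Cmod (a k) * Cmod h0 ^ k <= 2 * M0 + 1).
  { intros k. rewrite <- Cmod_pow, <- Cmod_mult.
    assert (HM0' : forall n, Cmod (sum_n (G := C_AbelianMonoid)
                                (fun k => a k * h0 ^ k)%C n) <= M0).
    { exact HM0. }
    assert (P0 := Rle_trans _ _ _ (Cmod_ge_0 _) (HM0' 0%nat)).
    destruct k as [|k].
    - specialize (HM0' 0%nat). rewrite sum_O in HM0'. lra.
    - assert (H1 := HM0' k). assert (H2 := HM0' (S k)).
      rewrite sum_Sn in H2.
      set (p := sum_n _ k) in *. set (x := (a (S k) * h0 ^ S k)%C) in *.
      change (Cmod (p + x)%C <= M0) in H2.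
      replace x with ((p + x) + (- p))%C by ring.
      eapply Rle_trans; [apply Cmod_triangle|]. rewrite Cmod_opp. lra. }
  set (M := 2 * M0 + 1) in *.
  assert (HMpos : 0 <= M).
  { specialize (HM 0%nat). simpl in HM. assert (H := Cmod_ge_0 (a 0%nat)). lra. }
  destruct (Ceq_dec (a 0%nat) (RtoC 0)) as [E|E]; [exact E|exfalso].
  assert (Hpos := proj1 (Cmod_gt_0 _) E).
  (* With q < 1/2 one has 1 / (1 - q) <= 2, so M q / (1 - q) <= 2 M q < |a 0|. *)
  pose (q0 := Rmin (1 / 2) (Cmod (a 0%nat) / (2 * M + 1))).
  assert (Hq0 : 0 < q0).
  { apply Rmin_glb_lt; [lra|]. apply Rdiv_lt_0_compat; lra. }
  destruct (Ha (q0 * Cmod h0)) as (h & [Hh Hhd] & Hs).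
  { now apply Rmult_lt_0_compat. }
  apply is_pseries_C in Hs.
  set (q := Cmod h / Cmod h0).
  assert (Hq : 0 < q < q0).
  { unfold q; split; [now apply Rdiv_lt_0_compat|].
    apply Rlt_div_l; lra. }
  assert (Hq1 : q < 1 / 2) by (eapply Rlt_le_trans; [apply Hq | apply Rmin_l]).
  assert (Hq2 : q * (2 * M + 1) < Cmod (a 0%nat)).
  { apply Rlt_div_r; [lra|]. eapply Rlt_le_trans; [apply Hq | apply Rmin_r]. }
  assert (Hle : Cmod (- a 0%nat)%C <= M * q * / (1 - q)).
  { apply (is_series_norm_le (V := C_NormedModule)
             (fun k => a (S k) * h ^ S k)%C (fun k => M * q * q ^ k)).
    - intros k. change (Cmod (a (S k) * h ^ S k)%C <= M * q * q ^ k).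
      rewrite Cmod_mult, Cmod_pow.
      replace (Cmod h) with (q * Cmod h0)
        by (unfold q; field; apply Rgt_not_eq, Hh0).
      rewrite Rpow_mult_distr.
      replace (M * q * q ^ k) with (M * q ^ S k) by (simpl; ring).
      replace (Cmod (a (S k)) * (q ^ S k * Cmod h0 ^ S k))
        with (Cmod (a (S k)) * Cmod h0 ^ S k * q ^ S k) by ring.
      apply Rmult_le_compat_r; [apply pow_le; lra | apply HM].
    - apply (is_series_incr_1 (V := C_NormedModule) (fun k => a k * h ^ k)%C).
      replace (plus _ _) with (RtoC 0); [exact Hs|].
      unfold plus; simpl. ring.
    - apply (is_series_scal_l (K := R_AbsRing) (V := R_NormedModule)
                (M * q) (fun k => q ^ k) (/ (1 - q))).
      apply is_series_geom. rewrite Rabs_pos_eq; lra. }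
  rewrite Cmod_opp in Hle.
  assert (Hinv : / (1 - q) <= 2).
  { rewrite <- (Rinv_inv 2). apply Rinv_le_contravar; lra. }
  assert (Hmq : 0 <= M * q) by (apply Rmult_le_pos; lra).
  assert (M * q * / (1 - q) <= M * q * 2) by (now apply Rmult_le_compat_l).
  lra.
Qed.

(** Once the constant coefficient vanishes, dividing by [h] shifts the
    coefficients and keeps all the zeros, so induction applies. *)
Lemma zeros_cluster_coef (a : nat -> C) :
  zeros_cluster a -> forall k, a k = RtoC 0.
Proof.
  intros Ha k. revert a Ha. induction k as [|k IH]; intros a Ha.
  - now apply zeros_cluster_coef0.
  - apply (IH (PS_decr_1 (V := C_NormedModule) a)).
    intros delta Hd. destruct (Ha delta Hd) as (h & Hh & Hs).
    exists h. split; [exact Hh|].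
    assert (Hne : h <> RtoC 0) by (apply Cmod_gt_0, Hh).
    assert (Hinv : mult (/ h)%C (h : C_Ring) = one).
    { change ((/ h * h)%C = RtoC 1). now field. }
    assert (H := is_pseries_decr_1 (V := C_NormedModule) a h (/ h)%C _ Hinv Hs).
    rewrite (zeros_cluster_coef0 a Ha) in H.
    replace (RtoC 0) with
      (scal (/ h)%C (plus (RtoC 0) (opp (RtoC 0 : C_NormedModule)))); [exact H|].
    change ((/ h * (RtoC 0 + - RtoC 0))%C = RtoC 0). ring.
Qed.

Lemma analytic_zeros_isolated (f : C -> C) (z0 : C) :
  analytic_at f z0 ->
  (forall delta, 0 < delta ->
     exists z, 0 < Cmod (z - z0)%C < delta /\ f z = RtoC 0) ->
  exists r, 0 < r /\ forall z, Cmod (z - z0)%C < r -> f z = RtoC 0.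
Proof.
  intros (a & r & Hr & Ha) Hz.
  assert (Hacc : zeros_cluster a).
  { intros delta Hd.
    destruct (Hz (Rmin delta r)) as (z & [Hz1 Hz2] & Hz0);
      [now apply Rmin_glb_lt|].
    exists (z - z0)%C. split.
    - split; [exact Hz1|]. eapply Rlt_le_trans; [exact Hz2 | apply Rmin_l].
    - rewrite <- Hz0. apply Ha.
      eapply Rlt_le_trans; [exact Hz2 | apply Rmin_r]. }
  assert (Ha0 := zeros_cluster_coef a Hacc).
  exists r; split; [exact Hr|]. intros z Hzr.
  specialize (Ha z Hzr). apply is_pseries_C in Ha.
  assert (H0 : @is_series C_AbsRing C_NormedModule
                 (fun k => a k * (z - z0) ^ k)%C (RtoC 0)).
  { apply (is_series_ext (V := C_NormedModule) (fun _ => RtoC 0)).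
    - intros n. rewrite Ha0.
      change (RtoC 0 = RtoC 0 * (z - z0) ^ n)%C. ring.
    - unfold is_series. apply (filterlim_ext (fun _ : nat => RtoC 0)).
      + intros n. induction n as [|n IH]; [now rewrite sum_O|].
        rewrite sum_Sn, <- IH. change (RtoC 0 = RtoC 0 + RtoC 0)%C. ring.
      + apply filterlim_const. }
  exact (filterlim_locally_unique (V := C_NormedModule) _ _ _ Ha H0).
Qed.

(** Let [t] be the least parameter such that [f] vanishes on the part of the
    segment from [t p] to [p].  Zeros accumulate at [t p], so [f] vanishes on a
    whole disc around it, which contradicts minimality unless [t = 0].  The
    proof uses [u = 1 - t], so that this least parameter is a supremum. *)
Lemma analytic_zero_along_segment (f : C -> C) (p : C) :
  p <> RtoC 0 ->
  (forall t, 0 <= t <= 1 -> analytic_at f (RtoC t * p)) ->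
  (exists r, 0 < r /\ forall z, Cmod (z - p)%C < r -> f z = RtoC 0) ->
  f (RtoC 0) = RtoC 0.
Proof.
  intros Hp Han (r0 & Hr0 & Hf0).
  assert (Hpp := proj1 (Cmod_gt_0 _) Hp).
  assert (Hdist : forall s t, Cmod (RtoC s * p - RtoC t * p)%C
                              = Rabs (s - t) * Cmod p).
  { intros s t. rewrite <- Cmod_R, <- Cmod_mult. f_equal.
    rewrite RtoC_minus. ring. }
  pose (E := fun u => 0 <= u <= 1 /\
               forall t, 1 - u <= t <= 1 -> f (RtoC t * p)%C = RtoC 0).
  destruct (completeness E) as [u [Hub Hlub]].
  { exists 1. intros x [Hx _]. lra. }
  { exists 0. split; [lra|]. intros t Ht. apply Hf0.
    replace t with 1 by lra. replace (RtoC 1 * p - p)%C with (RtoC 0) by ring.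
    now rewrite Cmod_0. }
  (* A disc of zeros around the current end point extends the zero segment. *)
  assert (Hext : forall v r, 0 <= v <= 1 -> 0 < r ->
            (forall t, 1 - v < t <= 1 -> f (RtoC t * p)%C = RtoC 0) ->
            (forall z, Cmod (z - RtoC (1 - v) * p)%C < r -> f z = RtoC 0) ->
            E (Rmin 1 (v + r / (2 * Cmod p)))).
  { intros v r Hv Hr H1 H2.
    assert (Hq : 0 < r / (2 * Cmod p)) by (apply Rdiv_lt_0_compat; lra).
    split.
    - split; [apply Rmin_glb; lra | apply Rmin_l].
    - intros t Ht. destruct (Rlt_dec (1 - v) t) as [Hlt|Hge].
      + apply H1; lra.
      + apply H2. rewrite Hdist, Rabs_left1 by lra.
        assert (- (t - (1 - v)) <= r / (2 * Cmod p)).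
        { assert (H := Rmin_r 1 (v + r / (2 * Cmod p))). lra. }
        apply Rle_lt_trans with (r / (2 * Cmod p) * Cmod p).
        * apply Rmult_le_compat_r; lra.
        * replace (r / (2 * Cmod p) * Cmod p) with (r / 2)
            by (field; lra). lra. }
  assert (Hu0 : 0 < u).
  { assert (HE : E (Rmin 1 (0 + r0 / (2 * Cmod p)))).
    { apply Hext; [lra | exact Hr0 | intros t Ht; lra |].
      intros z Hz. apply Hf0. replace (1 - 0) with 1 in Hz by ring.
      now replace (RtoC 1 * p)%C with p in Hz by ring. }
    apply Hub in HE.
    assert (Hq : 0 < r0 / (2 * Cmod p)) by (apply Rdiv_lt_0_compat; lra).
    assert (0 < Rmin 1 (0 + r0 / (2 * Cmod p))) by (apply Rmin_glb_lt; lra).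
    lra. }
  assert (Hu1 : u <= 1) by (apply Hlub; intros x [Hx _]; lra).
  assert (Hright : forall t, 1 - u < t <= 1 -> f (RtoC t * p)%C = RtoC 0).
  { intros t Ht.
    destruct (Classical_Prop.classic (f (RtoC t * p)%C = RtoC 0)) as [H|H];
      [exact H|exfalso].
    assert (u <= 1 - t); [|lra].
    apply Hlub. intros x [Hx Hfx].
    destruct (Rle_dec x (1 - t)) as [Hle|Hgt]; [exact Hle|].
    exfalso. apply H, Hfx. lra. }
  destruct (analytic_zeros_isolated f (RtoC (1 - u) * p)%C) as (r & Hr & Hfr).
  { apply Han; lra. }
  { intros delta Hd.
    pose (e := Rmin u (delta / (2 * Cmod p))).
    assert (Hq : 0 < delta / (2 * Cmod p)) by (apply Rdiv_lt_0_compat; lra).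
    assert (He : 0 < e) by (apply Rmin_glb_lt; lra).
    assert (He1 : e <= u) by apply Rmin_l.
    assert (He2 : e <= delta / (2 * Cmod p)) by apply Rmin_r.
    exists (RtoC (1 - u + e) * p)%C. split; [|apply Hright; lra].
    rewrite Hdist. replace (1 - u + e - (1 - u)) with e by ring.
    rewrite Rabs_pos_eq by lra. split; [now apply Rmult_lt_0_compat|].
    apply Rle_lt_trans with (delta / (2 * Cmod p) * Cmod p).
    - apply Rmult_le_compat_r; lra.
    - replace (delta / (2 * Cmod p) * Cmod p) with (delta / 2)
        by (field; lra). lra. }
  assert (HE : E (Rmin 1 (u + r / (2 * Cmod p)))) by (apply Hext; auto; lra).
  apply Hub in HE.
  assert (Hq : 0 < r / (2 * Cmod p)) by (apply Rdiv_lt_0_compat; lra).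
  assert (u = 1).
  { destruct (Rle_dec 1 (u + r / (2 * Cmod p))) as [H|H].
    - rewrite Rmin_left in HE by exact H. lra.
    - rewrite Rmin_right in HE by lra. lra. }
  apply Hfr. replace (1 - u) with 0 by lra.
  replace (RtoC 0 - RtoC 0 * p)%C with (RtoC 0) by ring. now rewrite Cmod_0.
Qed.

(** * Analytic functions from power series *)

(** The coefficient of [h^j] in [(w + h)^k], obtained from multiplication by
    [w + h] rather than from binomial coefficients: in this form the
    operations on power series give the expansion and its majorant by
    induction on [k]. *)
Fixpoint shift_pow_coef (w : C) (k : nat) : nat -> C :=
  match k with
  | O => fun j => match j with O => RtoC 1 | S _ => RtoC 0 end
  | S k => PS_plus (V := C_NormedModule)
             (PS_scal (V := C_NormedModule) w (shift_pow_coef w k))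
             (PS_incr_1 (V := C_NormedModule) (shift_pow_coef w k))
  end.

Lemma is_pseries_unit (c z : C) :
  @is_pseries C_AbsRing C_NormedModule
    (fun j => match j with O => c | S _ => RtoC 0 end) z c.
Proof.
  apply is_pseries_C. unfold is_series.
  apply (filterlim_ext (fun _ : nat => c)); [|apply filterlim_const].
  intros n. induction n as [|n IH].
  - rewrite sum_O. change (c = c * 1)%C. ring.
  - rewrite sum_Sn, <- IH. change (c = c + RtoC 0 * z ^ S n)%C. ring.
Qed.

Lemma is_pseries_shift_pow (w h : C) (k : nat) :
  @is_pseries C_AbsRing C_NormedModule (shift_pow_coef w k) h ((w + h) ^ k)%C.
Proof.
  induction k as [|k IH].
  - apply is_pseries_unit.
  - change ((w + h) ^ S k)%C with ((w + h) * (w + h) ^ k)%C.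
    rewrite Cmult_plus_distr_r. simpl shift_pow_coef.
    apply (is_pseries_plus (V := C_NormedModule)).
    + apply (is_pseries_scal (V := C_NormedModule)); [apply Cmult_comm|exact IH].
    + apply (is_pseries_incr_1 (V := C_NormedModule)). exact IH.
Qed.

Lemma shift_pow_coef_sum_le (w : C) (r : R) (k N : nat) : 0 <= r ->
  sum_n (fun j => Cmod (shift_pow_coef w k j) * r ^ j) N <= (Cmod w + r) ^ k.
Proof.
  intros Hr. revert N. induction k as [|k IH]; intros N.
  - simpl. destruct N as [|N].
    + rewrite sum_O. rewrite Cmod_1. simpl; lra.
    + apply Req_le. induction N as [|N IHN].
      * rewrite sum_Sn, sum_O, Cmod_1, Cmod_0. unfold plus; simpl; ring.
      * rewrite sum_Sn, IHN, Cmod_0. unfold plus; simpl; ring.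
  - set (T := shift_pow_coef w k) in *.
    assert (Hinc : sum_n (fun j => Cmod (PS_incr_1 (V := C_NormedModule) T j)
                                   * r ^ j) N <= r * (Cmod w + r) ^ k).
    { destruct N as [|N].
      - rewrite sum_O. simpl. change (Cmod (RtoC 0) * 1 <= r * (Cmod w + r) ^ k).
        rewrite Cmod_0.
        assert (0 <= r * (Cmod w + r) ^ k); [|lra].
        apply Rmult_le_pos; [exact Hr|].
        apply pow_le. assert (H := Cmod_ge_0 w). lra.
      - eapply Rle_trans; [|apply Rmult_le_compat_l; [exact Hr|apply (IH N)]].
        apply Req_le. clear IH. induction N as [|N IHN].
        + rewrite sum_Sn, !sum_O. unfold plus; simpl.
          change (zero : C) with (RtoC 0). rewrite Cmod_0. ring.
        + rewrite sum_Sn, IHN, sum_Sn. unfold plus; simpl. ring. }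
    assert (Hw := Rmult_le_compat_l _ _ _ (Cmod_ge_0 w) (IH N)).
    rewrite <- (sum_n_mult_l (K := R_Ring)) in Hw.
    change ((Cmod w + r) ^ S k) with ((Cmod w + r) * (Cmod w + r) ^ k).
    apply Rle_trans with
      (plus (sum_n (fun j => mult (Cmod w) (Cmod (T j) * r ^ j)) N)
         (sum_n (fun j => Cmod (PS_incr_1 (V := C_NormedModule) T j)
                          * r ^ j) N)).
    + rewrite <- sum_n_plus. apply sum_n_m_le. intros j.
      change (Cmod (w * T j + PS_incr_1 (V := C_NormedModule) T j)%C * r ^ j <=
              Cmod w * (Cmod (T j) * r ^ j)
              + Cmod (PS_incr_1 (V := C_NormedModule) T j) * r ^ j).
      rewrite <- Rmult_assoc, <- Cmod_mult, <- Rmult_plus_distr_r.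
      apply Rmult_le_compat_r; [now apply pow_le | apply Cmod_triangle].
    + rewrite Rmult_plus_distr_r. apply Rplus_le_compat; [exact Hw|exact Hinc].
Qed.

(** Re-expansion at [w]: the double series of
    [a k * shift_pow_coef w k j * h^j] is dominated by
    [|a k| (|w| + r)^k] with [|w| + r < rho], so it may be summed by powers of
    [h] first.  Each column sum depends on [h] only through the factor [h^j],
    so the coefficients can be read off at the single value [h = r]. *)
Lemma pseries_analytic (a : nat -> C) (rho : R) (f : C -> C) (w : C) :
  ex_series (fun k => Cmod (a k) * rho ^ k) ->
  (forall z, Cmod z < rho -> @is_pseries C_AbsRing C_NormedModule a z (f z)) ->
  Cmod w < rho -> analytic_at f w.
Proof.
  intros Ha Hf Hw.
  assert (Hw0 := Cmod_ge_0 w).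
  (* Half the distance to the boundary, so that |w| + r < rho. *)
  pose (r := (rho - Cmod w) / 2).
  assert (Hr : 0 < r) by (unfold r; lra).
  pose (u := fun (h : C) k j => (a k * (shift_pow_coef w k j * h ^ j))%C).
  assert (Hex : forall h, Cmod h <= r -> exists A : nat -> C,
    (forall j, @is_series C_AbsRing C_NormedModule (fun k => u h k j) (A j)) /\
    @is_series C_AbsRing C_NormedModule A (f (w + h)%C)).
  { intros h Hh.
    destruct (series_exchange (V := C_CompleteNormedModule) (u h)
                (fun k => Cmod (a k) * rho ^ k)
                (fun k => a k * (w + h) ^ k)%C) as (A & s & HA & _ & Hs & HAs).
    - intros k N.
      apply Rle_trans with
        (sum_n (fun j => mult (Cmod (a k))
                           (Cmod (shift_pow_coef w k j) * r ^ j)) N).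
      + apply sum_n_m_le. intros j.
        change (Cmod (u h k j) <=
                Cmod (a k) * (Cmod (shift_pow_coef w k j) * r ^ j)).
        unfold u. rewrite !Cmod_mult, Cmod_pow.
        apply Rmult_le_compat_l; [apply Cmod_ge_0|].
        apply Rmult_le_compat_l; [apply Cmod_ge_0|].
        apply pow_incr. split; [apply Cmod_ge_0 | exact Hh].
      + rewrite (sum_n_mult_l (K := R_Ring)). unfold mult; simpl.
        apply Rmult_le_compat_l; [apply Cmod_ge_0|].
        eapply Rle_trans; [apply shift_pow_coef_sum_le; lra|].
        apply pow_incr. unfold r; lra.
    - exact Ha.
    - intros k. unfold u.
      apply (is_series_scal_l (K := C_AbsRing) (V := C_NormedModule) (a k)).
      apply is_pseries_C, is_pseries_shift_pow.
    - exists A. split; [exact HA|].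
      replace (f (w + h)%C) with s; [exact HAs|].
      assert (Hz : Cmod (w + h)%C < rho).
      { eapply Rle_lt_trans; [apply Cmod_triangle|]. unfold r in *; lra. }
      specialize (Hf _ Hz). apply is_pseries_C in Hf.
      exact (filterlim_locally_unique (V := C_NormedModule) _ _ _ Hs Hf). }
  destruct (Hex (RtoC r)) as (A & HA & _).
  { rewrite Cmod_R, Rabs_pos_eq; lra. }
  assert (Hr0 : RtoC r <> RtoC 0) by (intros E; apply RtoC_inj in E; lra).
  exists (fun j => (A j / RtoC r ^ j)%C), r. split; [exact Hr|].
  intros z Hz.
  destruct (Hex (z - w)%C) as (A' & HA' & Hs); [lra|].
  replace (w + (z - w))%C with z in Hs by ring.
  apply is_pseries_C.
  refine (is_series_ext (V := C_NormedModule) A' _ _ _ Hs).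
  intros j.
  assert (Hj : @is_series C_AbsRing C_NormedModule
                 (fun k => u (z - w)%C k j) ((z - w) ^ j / RtoC r ^ j * A j)%C).
  { apply (is_series_ext (V := C_NormedModule)
             (fun k => ((z - w) ^ j / RtoC r ^ j * u (RtoC r) k j)%C)).
    - intros k. unfold u.
      set (x := (z - w)%C). set (c := shift_pow_coef w k j).
      change ((x ^ j / RtoC r ^ j * (a k * (c * RtoC r ^ j)))%C
              = (a k * (c * x ^ j))%C).
      field. now apply Cpow_nz.
    - apply (is_series_scal_l (K := C_AbsRing) (V := C_NormedModule)
               ((z - w) ^ j / RtoC r ^ j)%C (fun k => u (RtoC r) k j)).
      apply HA. }
  rewrite (filterlim_locally_unique (V := C_NormedModule) _ _ _ (HA' j) Hj).
  change (((z - w) ^ j / RtoC r ^ j * A j)%C = (A j / RtoC r ^ j * (z - w) ^ j)%C).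
  unfold Cdiv. ring.
Qed.

Lemma analytic_minus (f g : C -> C) (z0 : C) :
  analytic_at f z0 -> analytic_at g z0 ->
  analytic_at (fun z => f z - g z)%C z0.
Proof.
  intros (a & r & Hr & Ha) (b & s & Hs & Hb).
  exists (PS_minus (V := C_NormedModule) a b), (Rmin r s).
  split; [now apply Rmin_glb_lt|]. intros z Hz.
  apply (is_pseries_minus (V := C_NormedModule)).
  - apply Ha. eapply Rlt_le_trans; [exact Hz | apply Rmin_l].
  - apply Hb. eapply Rlt_le_trans; [exact Hz | apply Rmin_r].
Qed.

Lemma analytic_const (c z0 : C) : analytic_at (fun _ => c) z0.
Proof.
  exists (fun j => match j with O => c | S _ => RtoC 0 end), 1.
  split; [lra|]. intros z _. apply is_pseries_unit.
Qed.

Lemma analytic_mult_linear (f : C -> C) (c z0 : C) :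
  analytic_at f z0 -> analytic_at (fun z => (z - c) * f z)%C z0.
Proof.
  intros (a & r & Hr & Ha).
  exists (PS_plus (V := C_NormedModule)
            (PS_scal (V := C_NormedModule) (z0 - c)%C a)
            (PS_incr_1 (V := C_NormedModule) a)), r.
  split; [exact Hr|]. intros z Hz.
  replace ((z - c) * f z)%C with ((z0 - c) * f z + (z - z0) * f z)%C by ring.
  apply (is_pseries_plus (V := C_NormedModule)).
  - apply (is_pseries_scal (V := C_NormedModule)); [apply Cmult_comm | now apply Ha].
  - apply (is_pseries_incr_1 (V := C_NormedModule)). now apply Ha.
Qed.

Lemma analytic_translate (f : C -> C) (c z0 : C) :
  analytic_at f (z0 - c)%C -> analytic_at (fun z => f (z - c)%C) z0.
Proof.
  intros (a & r & Hr & Ha). exists a, r. split; [exact Hr|]. intros z Hz.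
  replace (z - z0)%C with (z - c - (z0 - c))%C in * by ring. now apply Ha.
Qed.

(** * Taylor coefficients of the trapezoid error *)

(** For [k >= 3] this is the coefficient of [h^(k-3)] in
    [x^(-h) = exp (- h ln x)].  The three leading zeros let the rule
    [is_derive_log_coef] hold without exception through the three
    differentiations that follow. *)
Definition log_coef (k : nat) (x : R) : R :=
  match k with
  | S (S (S j)) => (- ln x) ^ j / INR (fact j)
  | _ => 0
  end.

(** The coefficient of [h^k] in [(1 + h) x^(-2-h)], that is, in [(s-1) x^(-s)]
    at [s = 2 + h]. *)
Definition integrand_coef (k : nat) (x : R) : R :=
  (log_coef (S (S (S k))) x + log_coef (S (S k)) x) / x ^ 2.

(** The coefficient of [h^k] in [x^(-1-h) = x^(1-s)], whose derivative in [x] is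
    [- (s-1) x^(-s)]. *)
Definition boundary_coef (k : nat) (x : R) : R := log_coef (S (S (S k))) x / x.

(** The trapezoid error on [[n+1, n+2]] for [integrand_coef k]: trapezoid
    value minus integral, the latter computed with [- boundary_coef k] as
    primitive. *)
Definition trapezoid_coef (n k : nat) : R :=
  (integrand_coef k (INR n + 1) + integrand_coef k (INR n + 2)) / 2
  + boundary_coef k (INR n + 2) - boundary_coef k (INR n + 1).

Lemma is_derive_log_coef (k : nat) (x : R) : 0 < x ->
  is_derive (log_coef (S k)) x (- log_coef k x / x).
Proof.
  intros Hx. destruct k as [|[|[|j]]].
  1-3: unfold log_coef; auto_derive; [easy | simpl; field; lra].
  - unfold log_coef. auto_derive; [exact Hx|].
    change (fact j + j * fact j)%nat with (S j * fact j)%nat.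
    change (match j with O => 1 | S _ => INR j + 1 end) with (INR (S j)).
    rewrite mult_INR.
    assert (H1 := INR_fact_neq_0 j).
    assert (H2 : INR (S j) <> 0) by now apply not_0_INR.
    field. repeat split; (assumption || lra).
Qed.

(** The right-hand side is [(ln y)^j / j!], written as a value of [log_coef] so
    that its generating function is at hand. *)
Lemma log_coef_bound (k : nat) (x y : R) : 1 <= x <= y ->
  Rabs (log_coef k x) <= log_coef k (/ y).
Proof.
  intros Hxy. destruct k as [|[|[|j]]]; simpl; try (rewrite Rabs_R0; lra).
  rewrite ln_Rinv, Ropp_involutive by lra.
  assert (Hf : 0 < INR (fact j)) by apply INR_fact_lt_0.
  unfold Rdiv. rewrite Rabs_mult, (Rabs_pos_eq (/ _)).
  2: apply Rlt_le, Rinv_0_lt_compat, Hf.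
  apply Rmult_le_compat_r; [apply Rlt_le, Rinv_0_lt_compat, Hf|].
  rewrite <- RPow_abs, Rabs_Ropp.
  assert (H0 : 0 <= ln x) by (rewrite <- ln_1; apply ln_le; lra).
  rewrite Rabs_pos_eq by exact H0.
  apply pow_incr. split; [exact H0 | apply ln_le; lra].
Qed.

(** The trapezoid error on [[a, t]] has derivative
    [(f1 a - f1 t) / 2 + (t - a) f2 t / 2]; two further uses of the mean value
    theorem express it through [f3], the second derivative of [f1]. *)
Lemma trapezoid_error (f1 f2 f3 g : R -> R) (a M : R) :
  (forall t, a <= t <= a + 1 -> is_derive g t (- f1 t)) ->
  (forall t, a <= t <= a + 1 -> is_derive f1 t (f2 t)) ->
  (forall t, a <= t <= a + 1 -> is_derive f2 t (f3 t)) ->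
  (forall t, a <= t <= a + 1 -> Rabs (f3 t) <= M) ->
  Rabs ((f1 a + f1 (a + 1)) / 2 + g (a + 1) - g a) <= M.
Proof.
  intros Hg H1 H2 H3.
  assert (Hmvt : forall (f df : R -> R) b, a <= b <= a + 1 ->
            (forall t, a <= t <= a + 1 -> is_derive f t (df t)) ->
            forall b', a <= b' <= b ->
            exists c, b' <= c <= b /\ f b - f b' = df c * (b - b')).
  { intros f df b Hb Hf b' Hb'.
    destruct (MVT_gen f b' b df) as (c & Hc & E).
    - intros t Ht. rewrite Rmin_left, Rmax_right in Ht by lra. apply Hf; lra.
    - intros t Ht. rewrite Rmin_left, Rmax_right in Ht by lra.
      apply continuity_pt_filterlim, (ex_derive_continuous f t).
      exists (df t). apply Hf; lra.
    - rewrite Rmin_left, Rmax_right in Hc by lra. now exists c. }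
  destruct (Hmvt (fun t => (t - a) * (f1 a + f1 t) / 2 + g t)
              (fun t => (f1 a - f1 t) / 2 + (t - a) * f2 t / 2) (a + 1))
    with (b' := a) as (c & Hc & Ec); [lra| |lra|].
  { intros t Ht. auto_derive.
    - repeat split; [exists (f2 t); now apply H1 | exists (- f1 t); now apply Hg].
    - assert (E1 : Derive f1 t = f2 t) by now apply is_derive_unique, H1.
      assert (Eg : Derive g t = - f1 t) by now apply is_derive_unique, Hg.
      change (Derive (fun x : R => f1 x) t) with (Derive f1 t).
      change (Derive (fun x : R => g x) t) with (Derive g t).
      rewrite E1, Eg.
      field. }
  destruct (Hmvt f1 f2 c) with (b' := a) as (d & Hd & Ed);
    [lra | exact H1 | lra |].
  destruct (Hmvt f2 f3 c) with (b' := d) as (e & He & Ee);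
    [lra | exact H2 | lra |].
  replace ((f1 a + f1 (a + 1)) / 2 + g (a + 1) - g a)
    with (f3 e * ((c - a) * (c - d) / 2)).
  - rewrite Rabs_mult.
    assert (0 <= (c - a) * (c - d) <= 1 * 1).
    { split; [apply Rmult_le_pos; lra | apply Rmult_le_compat; lra]. }
    rewrite (Rabs_pos_eq ((c - a) * (c - d) / 2)) by lra.
    assert (HM := H3 e ltac:(lra)).
    assert (0 <= Rabs (f3 e)) by apply Rabs_pos.
    apply Rle_trans with (Rabs (f3 e) * 1); [|lra].
    apply Rmult_le_compat_l; lra.
  - replace (f3 e * ((c - a) * (c - d) / 2))
      with ((c - a) / 2 * (f3 e * (c - d))) by field.
    rewrite <- Ee.
    replace ((c - a) / 2 * (f2 c - f2 d))
      with ((c - a) * f2 c / 2 - f2 d * (c - a) / 2) by field.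
    rewrite <- Ed. lra.
Qed.

(** The numbers 6, 11, 6, 1 are the coefficients of
    [(s-1) s (s+1) = (1+h)(2+h)(3+h)], the factor produced by
    differentiating [(s-1) x^(-s)] twice. *)
Lemma trapezoid_coef_bound (n k : nat) :
  Rabs (trapezoid_coef n k) <=
  (6 * log_coef (S (S (S k))) (/ (INR n + 2))
   + 11 * log_coef (S (S k)) (/ (INR n + 2))
   + 6 * log_coef (S k) (/ (INR n + 2)) + log_coef k (/ (INR n + 2)))
  / (INR n + 1) ^ 4.
Proof.
  unfold trapezoid_coef.
  assert (Hn := pos_INR n).
  replace (INR n + 2) with (INR n + 1 + 1) by ring.
  set (a := INR n + 1). assert (Ha : 1 <= a) by (unfold a; lra).
  pose (f2 := fun x => - (2 * log_coef (S (S (S k))) x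
                          + 3 * log_coef (S (S k)) x + log_coef (S k) x) / x ^ 3).
  pose (f3 := fun x => (6 * log_coef (S (S (S k))) x
                        + 11 * log_coef (S (S k)) x
                        + 6 * log_coef (S k) x + log_coef k x) / x ^ 4).
  assert (Hex : forall j t, a <= t <= a + 1 -> ex_derive (log_coef (S j)) t).
  { intros j t Ht. eexists. apply is_derive_log_coef. lra. }
  assert (HD : forall j t, a <= t <= a + 1 ->
            Derive (fun x => log_coef (S j) x) t = - log_coef j t / t).
  { intros j t Ht. apply is_derive_unique, is_derive_log_coef. lra. }
  apply (trapezoid_error (integrand_coef k) f2 f3 (boundary_coef k)).
  - intros t Ht. unfold boundary_coef, integrand_coef. generalize (Hex (S (S k)) t Ht).
    generalize (HD (S (S k)) t Ht).
    generalize (log_coef (S (S k))). generalize (log_coef (S (S (S k)))).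
    intros l3 l2 E3 X3. auto_derive; [repeat split; (assumption || lra)|].
    rewrite E3. field. lra.
  - intros t Ht. unfold f2, integrand_coef.
    generalize (Hex (S (S k)) t Ht) (Hex (S k) t Ht).
    generalize (HD (S (S k)) t Ht) (HD (S k) t Ht).
    generalize (log_coef (S k)).
    generalize (log_coef (S (S k))). generalize (log_coef (S (S (S k)))).
    intros l3 l2 l1 E3 E2 X3 X2.
    auto_derive; [repeat split; (assumption || nra)|].
    rewrite E3, E2. field. lra.
  - intros t Ht. unfold f2, f3.
    generalize (Hex (S (S k)) t Ht) (Hex (S k) t Ht) (Hex k t Ht).
    generalize (HD (S (S k)) t Ht) (HD (S k) t Ht) (HD k t Ht).
    generalize (log_coef k). generalize (log_coef (S k)).
    generalize (log_coef (S (S k))). generalize (log_coef (S (S (S k)))).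
    intros l3 l2 l1 l0 E3 E2 E1 X3 X2 X1.
    auto_derive; [repeat split; try assumption; apply (pow_nonzero t 3); lra|].
    rewrite E3, E2, E1. field. lra.
  - intros t Ht. unfold f3.
    assert (B3 := log_coef_bound (S (S (S k))) t (a + 1) ltac:(lra)).
    assert (B2 := log_coef_bound (S (S k)) t (a + 1) ltac:(lra)).
    assert (B1 := log_coef_bound (S k) t (a + 1) ltac:(lra)).
    assert (B0 := log_coef_bound k t (a + 1) ltac:(lra)).
    assert (Hpow : 0 < a ^ 4 <= t ^ 4).
    { split; [apply pow_lt; lra | apply pow_incr; lra]. }
    unfold Rdiv. rewrite Rabs_mult, (Rabs_pos_eq (/ t ^ 4)).
    2: apply Rlt_le, Rinv_0_lt_compat; lra.
    apply Rmult_le_compat; [apply Rabs_pos | | |apply Rinv_le_contravar; lra].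
    + apply Rlt_le, Rinv_0_lt_compat; lra.
    + apply Rabs_le_between in B3. apply Rabs_le_between in B2.
      apply Rabs_le_between in B1. apply Rabs_le_between in B0.
      apply Rabs_le_between. lra.
Qed.

Lemma log_coef_series3 (x h : R) :
  is_series (fun k => log_coef (S (S (S k))) x * h ^ k) (exp (- h * ln x)).
Proof.
  assert (H := is_exp_Reals (- h * ln x)). apply is_pseries_R in H.
  apply is_series_Rext with (2 := H). intros k. simpl.
  replace (- h * ln x) with (- ln x * h) by ring.
  rewrite Rpow_mult_distr. unfold Rdiv. ring.
Qed.

Lemma log_coef_series_shift (j : nat) (x h l : R) : log_coef j x = 0 ->
  is_series (fun k => log_coef (S k + j) x * h ^ k) l ->
  is_series (fun k => log_coef (k + j) x * h ^ k) (h * l).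
Proof.
  intros H0 H. apply is_series_decr_1.
  replace (plus _ _) with (h * l).
  - apply is_series_Rext with (2 := is_series_scal_l (K := R_AbsRing) h _ _ H).
    intros k. change (h * (log_coef (S k + j) x * h ^ k)
                      = log_coef (S k + j) x * (h * h ^ k)). ring.
  - change (h * l = h * l + - (log_coef (0 + j) x * h ^ 0)).
    change (0 + j)%nat with j. rewrite H0. ring.
Qed.

(** Passing from [j + 1] to [j] shifts the coefficients by one place, since the
    new constant term [log_coef j] is zero for [j < 3]. *)
Lemma log_coef_series (j : nat) (x h : R) : (j <= 3)%nat ->
  is_series (fun k => log_coef (k + j) x * h ^ k)
    (h ^ (3 - j) * exp (- h * ln x)).
Proof.
  intros Hj.
  assert (H3 : is_series (fun k => log_coef (k + 3) x * h ^ k)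
                 (exp (- h * ln x))).
  { apply is_series_Rext with (2 := log_coef_series3 x h).
    intros k. now rewrite Nat.add_comm. }
  assert (Hs : forall i l, (i < 3)%nat ->
            is_series (fun k => log_coef (k + S i) x * h ^ k) l ->
            is_series (fun k => log_coef (k + i) x * h ^ k) (h * l)).
  { intros i l Hi H. apply log_coef_series_shift.
    - destruct i as [|[|[|i]]]; [reflexivity..|lia].
    - apply is_series_Rext with (2 := H). intros k.
      now rewrite Nat.add_succ_r. }
  destruct j as [|[|[|[|j]]]]; [| | | |lia].
  - replace (h ^ (3 - 0) * exp (- h * ln x))
      with (h * (h * (h * exp (- h * ln x)))) by (simpl; ring).
    repeat (apply Hs; [lia|]); exact H3.
  - replace (h ^ (3 - 1) * exp (- h * ln x))
      with (h * (h * exp (- h * ln x))) by (simpl; ring).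
    repeat (apply Hs; [lia|]); exact H3.
  - replace (h ^ (3 - 2) * exp (- h * ln x))
      with (h * exp (- h * ln x)) by (simpl; ring).
    repeat (apply Hs; [lia|]); exact H3.
  - replace (h ^ (3 - 3) * exp (- h * ln x))
      with (exp (- h * ln x)) by (simpl; ring).
    exact H3.
Qed.

(** The trapezoid error for the integral of [(1+h) x^(-2-h)] over
    [[n+1, n+2]]. *)
Definition trapezoid_error_at (n : nat) (h : R) : R :=
  let x := INR n + 1 in
  let y := INR n + 2 in
  ((1 + h) * exp (- h * ln x) / x ^ 2 + (1 + h) * exp (- h * ln y) / y ^ 2) / 2
  + exp (- h * ln y) / y - exp (- h * ln x) / x.

Lemma trapezoid_series (n : nat) (h : R) :
  is_series (fun k => trapezoid_coef n k * h ^ k) (trapezoid_error_at n h).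
Proof.
  assert (Hn := pos_INR n).
  assert (Hx : INR n + 1 <> 0) by lra. assert (Hy : INR n + 2 <> 0) by lra.
  unfold trapezoid_coef, trapezoid_error_at, integrand_coef, boundary_coef.
  set (x := INR n + 1) in *. set (y := INR n + 2) in *. clearbody x y.
  assert (X3 := log_coef_series 3 x h ltac:(lia)).
  assert (X2 := log_coef_series 2 x h ltac:(lia)).
  assert (Y3 := log_coef_series 3 y h ltac:(lia)).
  assert (Y2 := log_coef_series 2 y h ltac:(lia)).
  simpl in X3, X2, Y3, Y2.
  set (ex := exp (- h * ln x)) in *. set (ey := exp (- h * ln y)) in *.
  clearbody ex ey.
  assert (H := is_series_Rplus _ _ _ _
           (is_series_Rplus _ _ _ _
             (is_series_Rscal (/ x ^ 2 / 2) _ _ (is_series_Rplus _ _ _ _ X3 X2))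
             (is_series_Rscal (/ y ^ 2 / 2) _ _ (is_series_Rplus _ _ _ _ Y3 Y2)))
           (is_series_Rplus _ _ _ _ (is_series_Rscal (/ y) _ _ Y3)
             (is_series_Rscal (- / x) _ _ X3))).
  apply is_series_Rconv with (3 := H).
  - intros k.
    replace (k + 3)%nat with (S (S (S k))) by lia.
    replace (k + 2)%nat with (S (S k)) by lia.
    generalize (log_coef (S (S (S k))) x) (log_coef (S (S k)) x)
      (log_coef (S (S (S k))) y) (log_coef (S (S k)) y) (h ^ k).
    intros. field. now split.
  - field. now split.
Qed.

(** At [s = 0] the integrand is the constant [-1], for which the trapezoid rule
    is exact. *)
Lemma trapezoid_error_of_constant (n : nat) : trapezoid_error_at n (-2) = 0.
Proof.
  unfold trapezoid_error_at. assert (Hn := pos_INR n).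
  set (x := INR n + 1). replace (INR n + 2) with (x + 1) by (unfold x; ring).
  assert (Hx : 1 <= x) by (unfold x; lra). clearbody x.
  assert (E : forall t, 0 < t -> exp (- -2 * ln t) = t ^ 2).
  { intros t Ht. replace (- -2 * ln t) with (ln t + ln t) by ring.
    rewrite exp_plus, exp_ln by exact Ht. ring. }
  rewrite !E by lra. field. lra.
Qed.

(** A power series at [2] has to reach [0], so the radius must exceed 2; and
    [trapezoid_majorant n] has the size of [n^(r - 4)] for the radius [r], so
    its summability forces [r < 3]. *)
Definition trapezoid_radius : R := 5 / 2.

Definition trapezoid_majorant (n : nat) : R :=
  (6 + 11 * trapezoid_radius + 6 * trapezoid_radius ^ 2 + trapezoid_radius ^ 3)
  * exp (trapezoid_radius * ln (INR n + 2))
  / (INR n + 1) ^ 4.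

Lemma trapezoid_coef_sums_le (n N : nat) :
  sum_n (fun k => Rabs (trapezoid_coef n k * trapezoid_radius ^ k)) N
  <= trapezoid_majorant n.
Proof.
  assert (Hn := pos_INR n).
  assert (Hr : 0 < trapezoid_radius) by (unfold trapezoid_radius; lra).
  set (b := fun k => (6 * log_coef (k + 3) (/ (INR n + 2))
                      + 11 * log_coef (k + 2) (/ (INR n + 2))
                      + 6 * log_coef (k + 1) (/ (INR n + 2))
                      + log_coef (k + 0) (/ (INR n + 2)))
                     / (INR n + 1) ^ 4 * trapezoid_radius ^ k).
  assert (Hab : forall k, Rabs (trapezoid_coef n k * trapezoid_radius ^ k) <= b k).
  { intros k. unfold b. rewrite Rabs_mult, (Rabs_pos_eq (trapezoid_radius ^ k)).
    2: apply pow_le; lra.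
    apply Rmult_le_compat_r; [apply pow_le; lra|].
    replace (k + 3)%nat with (S (S (S k))) by lia.
    replace (k + 2)%nat with (S (S k)) by lia.
    replace (k + 1)%nat with (S k) by lia.
    replace (k + 0)%nat with k by lia.
    apply trapezoid_coef_bound. }
  apply Rle_trans with (sum_n b N); [now apply sum_n_m_le|].
  apply sum_n_nonneg_le_series.
  { intros k. eapply Rle_trans; [apply Rabs_pos | apply Hab]. }
  unfold trapezoid_majorant.
  assert (L := fun j Hj => log_coef_series j (/ (INR n + 2)) trapezoid_radius Hj).
  rewrite ln_Rinv in L by lra.
  replace (- trapezoid_radius * - ln (INR n + 2))
    with (trapezoid_radius * ln (INR n + 2)) in L by ring.
  set (e := exp (trapezoid_radius * ln (INR n + 2))) in *.
  assert (H := is_series_Rscal (/ (INR n + 1) ^ 4) _ _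
           (is_series_Rplus _ _ _ _
             (is_series_Rplus _ _ _ _
               (is_series_Rscal 6 _ _ (L 3%nat ltac:(lia)))
               (is_series_Rscal 11 _ _ (L 2%nat ltac:(lia))))
             (is_series_Rplus _ _ _ _
               (is_series_Rscal 6 _ _ (L 1%nat ltac:(lia)))
               (L 0%nat ltac:(lia))))).
  apply is_series_Rconv with (3 := H).
  - intros k. unfold b.
    generalize (log_coef (k + 3) (/ (INR n + 2)))
      (log_coef (k + 2) (/ (INR n + 2))) (log_coef (k + 1) (/ (INR n + 2)))
      (log_coef (k + 0) (/ (INR n + 2))) (trapezoid_radius ^ k).
    intros. field. lra.
  - simpl. field. lra.
Qed.

(** The majorant has the size of [n^(-3/2)], which is dominated by the
    telescoping differences of [1 / sqrt n]. *)
Lemma ex_series_trapezoid_majorant : ex_series trapezoid_majorant.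
Proof.
  set (K := 6 + 11 * trapezoid_radius + 6 * trapezoid_radius ^ 2
            + trapezoid_radius ^ 3).
  assert (HK : 0 < K) by (unfold K, trapezoid_radius; lra).
  (* The constant 32 comes from x + 1 <= 2 x, used to the fourth power, and
     from s + t <= 2 t for s = sqrt x and t = sqrt (x + 1). *)
  set (d := fun n => / sqrt (INR n + 1) - / sqrt (INR n + 2)).
  assert (Hle : forall n, 0 <= trapezoid_majorant n <= 32 * K * d n).
  { intros n. unfold trapezoid_majorant, d. fold K. assert (Hn := pos_INR n).
    replace (INR n + 2) with (INR n + 1 + 1) by ring.
    set (x := INR n + 1). assert (Hx : 1 <= x) by (unfold x; lra). clearbody x.
    clear n Hn.
    assert (E : exp (trapezoid_radius * ln (x + 1)) = (x + 1) ^ 2 * sqrt (x + 1)).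
    { rewrite <- (Rpower_sqrt (x + 1)), <- (Rpower_pow 2) by lra.
      rewrite <- Rpower_plus. unfold Rpower. f_equal. f_equal.
      unfold trapezoid_radius. simpl. field. }
    rewrite E. clear E.
    assert (Hs : 0 < sqrt x) by (apply sqrt_lt_R0; lra).
    assert (Hsx := sqrt_sqrt x ltac:(lra)).
    assert (Hsy := sqrt_sqrt (x + 1) ltac:(lra)).
    assert (Hst : sqrt x <= sqrt (x + 1)) by (apply sqrt_le_1; lra).
    set (s := sqrt x) in *. set (t := sqrt (x + 1)) in *. clearbody s t.
    assert (Hx4 : 0 < x ^ 4) by (apply pow_lt; lra).
    split.
    { apply Rdiv_le_0_compat; [|exact Hx4].
      apply Rmult_le_pos; [lra|]. apply Rmult_le_pos; [apply pow_le|]; lra. }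
    apply Rle_trans with (16 * K * / ((x + 1) * t)).
    - apply Rle_div_l; [exact Hx4|].
      apply Rmult_le_reg_r with ((x + 1) * t); [apply Rmult_lt_0_compat; lra|].
      replace (16 * K * / ((x + 1) * t) * x ^ 4 * ((x + 1) * t))
        with (K * (2 * x) ^ 4) by (field; lra).
      replace (K * ((x + 1) ^ 2 * t) * ((x + 1) * t))
        with (K * ((x + 1) ^ 3 * (t * t))) by ring.
      rewrite Hsy.
      replace ((x + 1) ^ 3 * (x + 1)) with ((x + 1) ^ 4) by ring.
      apply Rmult_le_compat_l; [lra|]. apply pow_incr; lra.
    - replace (/ s - / t) with (/ (s * t * (s + t))).
      2:{ assert (Ht2 : t * t - s * s = 1) by lra.
          replace (/ s - / t) with ((t * t - s * s) / (s * t * (s + t)))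
            by (field; lra).
          rewrite Ht2. unfold Rdiv; ring. }
      replace (32 * K * / (s * t * (s + t)))
        with (16 * K * / (s * t * ((s + t) / 2))) by (field; lra).
      apply Rmult_le_compat_l; [lra|].
      apply Rinv_le_contravar.
      + repeat apply Rmult_lt_0_compat; lra.
      + rewrite <- Hsy. apply Rmult_le_compat; [nra|lra| |lra].
        apply Rmult_le_compat; lra. }
  assert (Hd0 : forall n, 0 <= d n).
  { intros n. assert (H := Hle n). nra. }
  apply (ex_series_le (K := R_AbsRing) (V := R_CompleteNormedModule)
           trapezoid_majorant (fun n => 32 * K * d n)).
  - intros n. unfold norm; simpl. unfold abs; simpl.
    rewrite Rabs_pos_eq; apply Hle.
  - apply (ex_series_scal_l (K := R_AbsRing) (V := R_NormedModule)).
    apply ex_series_bounded_sums with 1; [exact Hd0|].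
    assert (E : forall N, sum_n d N = 1 - / sqrt (INR N + 2)).
    { intros N. induction N as [|N IH].
      - rewrite sum_O. change (d 0%nat = 1 - / sqrt (INR 0 + 2)).
        unfold d. simpl INR. now rewrite !Rplus_0_l, sqrt_1, Rinv_1.
      - rewrite sum_Sn, IH.
        change (1 - / sqrt (INR N + 2) + d (S N) = 1 - / sqrt (INR (S N) + 2)).
        unfold d. rewrite S_INR.
        replace (INR N + 1 + 1) with (INR N + 2) by ring. ring. }
    intros N. rewrite E. assert (Hn := pos_INR N).
    assert (0 < / sqrt (INR N + 2)); [|lra].
    apply Rinv_0_lt_compat, sqrt_lt_R0. lra.
Qed.

(** * The value of zeta at 0 *)

(** The coefficients are defined by interchanging summation at the largest [h],
    where absolute convergence is weakest; the interchange at the other [h]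
    then yields the same coefficients. *)
Lemma trapezoid_pseries :
  exists a : nat -> R, ex_series (fun k => Rabs (a k) * trapezoid_radius ^ k) /\
    forall h, Rabs h <= trapezoid_radius -> exists S,
      is_series (fun n => trapezoid_error_at n h) S /\
      is_series (fun k => a k * h ^ k) S.
Proof.
  assert (Hr : 0 < trapezoid_radius) by (unfold trapezoid_radius; lra).
  assert (Hex : forall h, Rabs h <= trapezoid_radius -> exists A S,
            (forall k, is_series (fun n => trapezoid_coef n k * h ^ k) (A k)) /\
            ex_series (fun k => Rabs (A k)) /\
            is_series (fun n => trapezoid_error_at n h) S /\ is_series A S).
  { intros h Hh.
    apply (series_exchange (V := R_CompleteNormedModule)
             (fun n k => trapezoid_coef n k * h ^ k) trapezoid_majorant).
    - intros n N. eapply Rle_trans; [|apply trapezoid_coef_sums_le].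
      apply sum_n_m_le. intros k.
      change (Rabs (trapezoid_coef n k * h ^ k)
              <= Rabs (trapezoid_coef n k * trapezoid_radius ^ k)).
      rewrite !Rabs_mult. apply Rmult_le_compat_l; [apply Rabs_pos|].
      rewrite <- !RPow_abs, (Rabs_pos_eq trapezoid_radius) by lra.
      apply pow_incr. split; [apply Rabs_pos | exact Hh].
    - apply ex_series_trapezoid_majorant.
    - intros n. apply trapezoid_series. }
  destruct (Hex trapezoid_radius) as (A & S0 & HA & HAabs & _).
  { rewrite Rabs_pos_eq; lra. }
  exists (fun k => A k / trapezoid_radius ^ k).
  assert (Hp : forall k, 0 < trapezoid_radius ^ k) by (intros k; now apply pow_lt).
  split.
  - apply (ex_series_ext (V := R_NormedModule) (fun k => Rabs (A k)));
      [|exact HAabs].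
    intros k. change (Rabs (A k)
                    = Rabs (A k / trapezoid_radius ^ k) * trapezoid_radius ^ k).
    unfold Rdiv. specialize (Hp k).
    rewrite Rabs_mult, (Rabs_pos_eq (/ _)).
    + field. lra.
    + apply Rlt_le, Rinv_0_lt_compat, Hp.
  - intros h Hh. destruct (Hex h Hh) as (A' & S & HA' & _ & HS & HAS).
    exists S. split; [exact HS|].
    apply is_series_Rext with (2 := HAS). intros k.
    assert (H := is_series_Rscal (h ^ k / trapezoid_radius ^ k) _ _ (HA k)).
    assert (H' : is_series (fun n => trapezoid_coef n k * h ^ k)
                   (h ^ k / trapezoid_radius ^ k * A k)).
    { apply is_series_Rext with (2 := H). intros n. specialize (Hp k).
      field. lra. }
    rewrite <- (is_series_unique _ _ (HA' k)), (is_series_unique _ _ H').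
    specialize (Hp k). field. lra.
Qed.

Lemma is_lim_seq_exp_neg_ln (c : R) : 0 < c ->
  is_lim_seq (fun n => exp (- c * ln (INR n + 2))) 0.
Proof.
  intros Hc.
  apply (is_lim_comp_seq exp (fun n => - c * ln (INR n + 2)) m_infty 0).
  - apply is_lim_exp_m.
  - exists 0%nat. intros n _. discriminate.
  - replace m_infty with (Rbar_mult (- c) p_infty).
    2:{ simpl. destruct (Rle_dec 0 (- c)) as [H|H]; [exfalso; lra|reflexivity]. }
    apply is_lim_seq_scal_l.
    apply (is_lim_comp_seq ln (fun n => INR n + 2) p_infty p_infty).
    + apply is_lim_ln_p.
    + exists 0%nat. intros n _. discriminate.
    + apply (is_lim_seq_plus _ _ p_infty 2); [apply is_lim_seq_INR
        | apply is_lim_seq_const | reflexivity].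
Qed.

(** Adding the trapezoid values counts each [n^(-s)] once except the first,
    which is counted half, and the integrals telescope to
    [1 - (N+2)^(1-s)]; hence the Euler-Maclaurin formula for [s = 2 + h]. *)
Lemma trapezoid_errors_sum (h Z : R) : Rabs h < 1 ->
  is_series (fun n => exp (- (2 + h) * ln (INR n + 1))) Z ->
  is_series (fun n => trapezoid_error_at n h) ((1 + h) * (Z - 1 / 2) - 1).
Proof.
  intros Hh HZ. apply Rabs_def2 in Hh.
  set (p := fun n => exp (- (2 + h) * ln (INR n + 1))) in *.
  assert (Hsq : forall x, 0 < x ->
            exp (- h * ln x) = exp (- (2 + h) * ln x) * x ^ 2).
  { intros x Hx. replace (x ^ 2) with (exp (2 * ln x)).
    - rewrite <- exp_plus. f_equal. ring.
    - replace (2 * ln x) with (ln x + ln x) by ring.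
      rewrite exp_plus, exp_ln by exact Hx. ring. }
  assert (E : forall N, sum_n (fun n => trapezoid_error_at n h) N =
            (1 + h) * (sum_n p N - 1 / 2 + / 2 * exp (- (2 + h) * ln (INR N + 2)))
            - 1 + exp (- (1 + h) * ln (INR N + 2))).
  { assert (Hlin : forall x, 0 < x ->
              exp (- (1 + h) * ln x) = exp (- (2 + h) * ln x) * x).
    { intros x Hx. rewrite <- (exp_ln x Hx) at 3. rewrite <- exp_plus.
      f_equal. ring. }
    assert (Ht : forall n, trapezoid_error_at n h =
              (1 + h) * (p n + exp (- (2 + h) * ln (INR n + 2))) / 2
              + exp (- (1 + h) * ln (INR n + 2)) - exp (- (1 + h) * ln (INR n + 1))).
    { intros n. unfold trapezoid_error_at, p. assert (Hn := pos_INR n).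
      rewrite !Hsq, !Hlin by lra. field. lra. }
    intros N. induction N as [|N IH].
    - rewrite !sum_O, Ht. unfold p. simpl INR. rewrite !Rplus_0_l, ln_1.
      rewrite !Rmult_0_r, exp_0.
      eq_in_R. field.
    - rewrite !sum_Sn, IH, Ht.
      set (q := sum_n p N). clearbody q. unfold plus; simpl plus.
      change (p (S N)) with (exp (- (2 + h) * ln (INR (S N) + 1))).
      rewrite S_INR. replace (INR N + 1 + 1) with (INR N + 2) by ring.
      simpl. eq_in_R. field. }
  change (is_lim_seq (sum_n (fun n => trapezoid_error_at n h))
            ((1 + h) * (Z - 1 / 2) - 1)).
  eapply is_lim_seq_ext; [intros N; symmetry; apply E|].
  replace ((1 + h) * (Z - 1 / 2) - 1)
    with ((1 + h) * (Z - 1 / 2 + / 2 * 0) - 1 + 0) by field.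
  apply is_lim_seq_plus'; [|apply is_lim_seq_exp_neg_ln; lra].
  apply is_lim_seq_minus'; [|apply is_lim_seq_const].
  apply (is_lim_seq_scal_l _ (1 + h) (Finite _)).
  apply is_lim_seq_plus'.
  - apply is_lim_seq_minus'; [exact HZ | apply is_lim_seq_const].
  - apply (is_lim_seq_scal_l _ (/ 2) (Finite _)).
    apply is_lim_seq_exp_neg_ln; lra.
Qed.

Lemma Rcpow_RtoC (x s : R) : Rcpow x (RtoC s) = RtoC (exp (s * ln x)).
Proof.
  unfold Rcpow, Cexp. rewrite <- RtoC_mult, re_RtoC, im_RtoC, cos_0, sin_0.
  now rewrite Rmult_1_r, Rmult_0_r.
Qed.

Lemma zeta_real_series (zeta : C -> C) (s : R) :
  is_riemann_zeta zeta -> 1 < s ->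
  exists Z, is_series (fun n => exp (- s * ln (INR n + 1))) Z /\
            zeta (RtoC s) = RtoC Z.
Proof.
  intros [Hser _] Hs.
  assert (H : @is_series C_AbsRing C_NormedModule
                (fun n => RtoC (exp (- s * ln (INR n + 1)))) (zeta (RtoC s))).
  { apply (is_series_ext (V := C_NormedModule)) with
      (2 := Hser (RtoC s) Hs).
    intros n. rewrite <- RtoC_opp, Rcpow_RtoC, S_INR. reflexivity. }
  destruct (is_series_C_pair _ _ H) as [HZ _].
  exists (Re (zeta (RtoC s))). split; [exact HZ|].
  exact (filterlim_locally_unique (V := C_NormedModule) _ _ _ H
           (is_series_RtoC _ _ HZ)).
Qed.

(** The function [f] of the proof is the Euler-Maclaurin formula with all terms
    on one side; the power series [P] in [s - 2] carries the trapezoid errors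
    to the left of the line [Re s = 1]. *)
Lemma zeta_at_0 (zeta : C -> C) :
  is_riemann_zeta zeta -> zeta (RtoC 0) = RtoC (- (1 / 2)).
Proof.
  intros Hz.
  destruct trapezoid_pseries as (a & Haabs & Ha).
  assert (Hr : trapezoid_radius = 5 / 2) by reflexivity.
  set (P := fun z => CSeries (fun k => RtoC (a k) * z ^ k)%C).
  assert (HPser : forall z l, @is_series C_AbsRing C_NormedModule
                    (fun k => RtoC (a k) * z ^ k)%C l -> P z = l).
  { intros z l. apply CSeries_unique. }
  assert (HPR : forall h l, is_series (fun k => a k * h ^ k) l ->
                  P (RtoC h) = RtoC l).
  { intros h l H. apply HPser.
    apply (is_series_ext (V := C_NormedModule)) with (2 := is_series_RtoC _ _ H).
    intros k. now rewrite RtoC_mult, RtoC_pow. }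
  assert (HPan : forall w, Cmod w < trapezoid_radius -> analytic_at P w).
  { intros w. apply (pseries_analytic (fun k => RtoC (a k)) trapezoid_radius).
    - apply (ex_series_ext (V := R_NormedModule)) with (2 := Haabs).
      intros k. now rewrite Cmod_R.
    - intros z Hzr. apply is_pseries_C.
      destruct (ex_series_le (V := C_CompleteNormedModule)
                  (fun k => RtoC (a k) * z ^ k)%C
                  (fun k => Rabs (a k) * trapezoid_radius ^ k)) as [l Hl].
      + intros k. change (Cmod (RtoC (a k) * z ^ k)%C
                          <= Rabs (a k) * trapezoid_radius ^ k).
        rewrite Cmod_mult, Cmod_pow, Cmod_R.
        apply Rmult_le_compat_l; [apply Rabs_pos|].
        apply pow_incr. split; [apply Cmod_ge_0 | lra].
      + exact Haabs.
      + rewrite (HPser z l Hl). exact Hl. }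
  set (f := fun s => ((s - RtoC 1) * (zeta s - RtoC (1 / 2)) - RtoC 1
                      - P (s - RtoC 2))%C).
  assert (Hfan : forall s, s <> RtoC 1 -> Cmod (s - RtoC 2)%C < trapezoid_radius ->
                   analytic_at f s).
  { intros s Hs1 Hs2. unfold f.
    apply analytic_minus; [|now apply (analytic_translate P), HPan].
    apply (analytic_minus (fun s => (s - RtoC 1) * (zeta s - RtoC (1 / 2)))%C
             (fun _ => RtoC 1)); [|apply analytic_const].
    apply (analytic_mult_linear (fun s => zeta s - RtoC (1 / 2))%C).
    apply (analytic_minus zeta (fun _ => RtoC (1 / 2)));
      [now apply Hz | apply analytic_const]. }
  assert (Hf2 : forall h, Rabs h < 1 -> f (RtoC (2 + h)) = RtoC 0).
  { intros h Hh. assert (Hh' := Rabs_def2 _ _ Hh).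
    destruct (zeta_real_series zeta (2 + h) Hz) as (Z & HZ & EZ); [lra|].
    destruct (Ha h) as (S & HS1 & HS2); [lra|].
    assert (ES := is_series_unique _ _ (trapezoid_errors_sum h Z Hh HZ)).
    rewrite (is_series_unique _ _ HS1) in ES.
    unfold f. replace (RtoC (2 + h) - RtoC 2)%C with (RtoC h)
      by (rewrite <- RtoC_minus; f_equal; ring).
    rewrite EZ, (HPR h S HS2), ES.
    rewrite <- !RtoC_minus, <- RtoC_mult, <- !RtoC_minus. f_equal. field. }
  assert (Hne : forall x y : R, x <> y -> RtoC x <> RtoC y).
  { intros x y Hxy E. apply RtoC_inj in E. auto. }
  destruct (analytic_zeros_isolated f (RtoC 2)) as (r & Hr0 & Hfr).
  { apply Hfan; [apply Hne; lra|]. rewrite <- RtoC_minus, Cmod_R.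
    replace (2 - 2) with 0 by ring. rewrite Rabs_R0. lra. }
  { intros delta Hd. set (h := Rmin (delta / 2) (1 / 2)).
    assert (Hh0 : 0 < h) by (apply Rmin_glb_lt; lra).
    assert (Hh1 : h <= delta / 2) by apply Rmin_l.
    assert (Hh2 : h <= 1 / 2) by apply Rmin_r.
    exists (RtoC (2 + h)). split.
    - rewrite <- RtoC_minus, Cmod_R. replace (2 + h - 2) with h by ring.
      rewrite Rabs_pos_eq; lra.
    - apply Hf2. rewrite Rabs_pos_eq; lra. }
  (* The segment starts at 2 + i d: d < r puts this point in the disc of zeros,
     d > 0 keeps it off 1, and d <= 1 keeps it within distance 2 of 2. *)
  set (d := Rmin (r / 2) 1).
  assert (Hd0 : 0 < d) by (apply Rmin_glb_lt; lra).
  assert (Hd1 : d <= r / 2) by apply Rmin_l.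
  assert (Hd2 : d <= 1) by apply Rmin_r.
  assert (HmI : forall y, Cmod (RtoC y * Ci)%C = Rabs y).
  { intros y. now rewrite Cmod_mult, Cmod_Ci, Cmod_R, Rmult_1_r. }
  assert (Hf0 : f (RtoC 0) = RtoC 0).
  { apply (analytic_zero_along_segment f (RtoC 2 + RtoC d * Ci)%C).
    - intros E. apply (f_equal Re) in E. simpl in E. lra.
    - intros t Ht. apply Hfan.
      + intros E. assert (E1 := f_equal Re E). assert (E2 := f_equal Im E).
        simpl in E1, E2.
        assert (t * d = 0) by lra. assert (t = 0) by nra. subst t. lra.
      + replace (RtoC t * (RtoC 2 + RtoC d * Ci) - RtoC 2)%C
          with (RtoC (t * 2 - 2) + RtoC (t * d) * Ci)%C
          by (rewrite RtoC_minus, !RtoC_mult; ring).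
        eapply Rle_lt_trans; [apply Cmod_triangle|].
        rewrite HmI, Cmod_R, Rabs_left1, Rabs_pos_eq by nra. nra.
    - exists (r / 2). split; [lra|]. intros z Hzr. apply Hfr.
      replace (z - RtoC 2)%C
        with ((z - (RtoC 2 + RtoC d * Ci)) + RtoC d * Ci)%C by ring.
      eapply Rle_lt_trans; [apply Cmod_triangle|].
      rewrite HmI, Rabs_pos_eq; lra. }
  assert (HP0 : P (RtoC (-2)) = RtoC 0).
  { destruct (Ha (-2)) as (S & HS1 & HS2); [rewrite Rabs_left; lra|].
    rewrite (HPR _ S HS2). f_equal. rewrite <- (is_series_unique _ _ HS1).
    apply is_series_unique.
    apply is_series_Rconv with (fun n => 0 * (1 / 2) ^ n)
      (0 * / (1 - 1 / 2)).
    - intros n. rewrite trapezoid_error_of_constant. ring.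
    - ring.
    - apply is_series_Rscal, is_series_geom. rewrite Rabs_pos_eq; lra. }
  unfold f in Hf0.
  replace (RtoC 0 - RtoC 2)%C with (RtoC (-2)) in Hf0
    by (rewrite <- RtoC_minus; f_equal; ring).
  rewrite HP0 in Hf0.
  replace (zeta (RtoC 0)) with
    (RtoC (1 / 2) - RtoC 1 - ((RtoC 0 - RtoC 1) * (zeta (RtoC 0) - RtoC (1 / 2))
       - RtoC 1 - RtoC 0))%C by ring.
  rewrite Hf0, <- !RtoC_minus. f_equal. field.
Qed.

(** * Sums over odd and even integers *)

Fixpoint odd_harmonic (n : nat) : R :=
  match n with
  | O => 0
  | S n => odd_harmonic n + / (2 * INR n + 1)
  end.

(** Extending the partial sums of the odd harmonic series to an even function on
    the integers makes [odd_harmonicZ_succ] hold on both sides of zero, so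
    that sums of [1 / (o - e)] telescope whether or not [o] passes [e]. *)
Definition odd_harmonicZ (z : Z) : R := odd_harmonic (Z.abs_nat z).

Lemma odd_harmonicZ_succ (z : Z) :
  odd_harmonicZ (z + 1) = odd_harmonicZ z + / (2 * IZR z + 1).
Proof.
  unfold odd_harmonicZ. destruct (Z_le_gt_dec 0 z) as [Hz|Hz].
  - replace (Z.abs_nat (z + 1)) with (S (Z.abs_nat z)) by lia.
    simpl. now rewrite INR_IZR_INZ, Zabs2Nat.id_abs, Z.abs_eq.
  - replace (Z.abs_nat z) with (S (Z.abs_nat (z + 1))) by lia.
    simpl. rewrite INR_IZR_INZ, Zabs2Nat.id_abs, Z.abs_neq by lia.
    rewrite opp_IZR, plus_IZR.
    assert (IZR z <= -1) by (apply IZR_le; lia). field. lra.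
Qed.

Lemma odd_harmonicZ_opp (z : Z) : odd_harmonicZ (- z) = odd_harmonicZ z.
Proof. unfold odd_harmonicZ. f_equal. lia. Qed.

Lemma odd_harmonicZ_gap (a d : Z) : (0 <= a)%Z -> (0 <= d)%Z ->
  0 <= odd_harmonicZ (a + d) - odd_harmonicZ a <= IZR d / (2 * IZR a + 1).
Proof.
  intros Ha Hd. pattern d; apply natlike_ind; [| |exact Hd].
  - rewrite Z.add_0_r. unfold Rdiv. rewrite Rmult_0_l. lra.
  - intros x Hx IH. unfold Z.succ.
    replace (a + (x + 1))%Z with (a + x + 1)%Z by ring.
    rewrite odd_harmonicZ_succ, !plus_IZR.
    assert (H0 := IZR_le _ _ Ha). assert (H1 := IZR_le _ _ Hx).
    assert (/ (2 * (IZR a + IZR x) + 1) <= / (2 * IZR a + 1))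
      by (apply Rinv_le_contravar; lra).
    assert (0 < / (2 * (IZR a + IZR x) + 1)) by (apply Rinv_0_lt_compat; lra).
    unfold Rdiv in *. rewrite Rmult_plus_distr_r. lra.
Qed.

(** The kernel [1 / (o^2 - e^2)] at [e = 2i + 2], [o = 2j + 1]. *)
Definition pole (i j : nat) : R :=
  / ((2 * INR j + 1) ^ 2 - (2 * INR i + 2) ^ 2).

Lemma odd_neq_even (i j : nat) : 2 * INR j + 1 - (2 * INR i + 2) <> 0.
Proof.
  rewrite !INR_IZR_INZ, <- !mult_IZR, <- !plus_IZR, <- minus_IZR.
  apply (not_0_IZR). lia.
Qed.

(** With [e = 2i + 2], the kernel is the difference of [1 / (o - e)] and
    [1 / (o + e)] divided by [2e], and each part telescopes. *)
Lemma pole_row_sum (i N : nat) :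
  sum_n (fun j => pole i j) N =
  (odd_harmonicZ (Z.of_nat N - Z.of_nat i)
   - odd_harmonicZ (Z.of_nat N + Z.of_nat i + 2)) / (4 * (INR i + 1)).
Proof.
  assert (Hi := pos_INR i).
  induction N as [|N IH].
  - rewrite sum_n_R0. unfold pole.
    replace (Z.of_nat 0 - Z.of_nat i)%Z with (- Z.of_nat i)%Z by lia.
    replace (Z.of_nat 0 + Z.of_nat i + 2)%Z with (Z.of_nat i + 1 + 1)%Z by lia.
    rewrite odd_harmonicZ_opp, !odd_harmonicZ_succ, plus_IZR, <- INR_IZR_INZ.
    simpl INR. eq_in_R. field. repeat split; try lra. nra.
  - rewrite sum_n_RS, IH. unfold pole.
    replace (Z.of_nat (S N) - Z.of_nat i)%Z
      with (Z.of_nat N - Z.of_nat i + 1)%Z by lia.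
    replace (Z.of_nat (S N) + Z.of_nat i + 2)%Z
      with (Z.of_nat N + Z.of_nat i + 2 + 1)%Z by lia.
    rewrite (odd_harmonicZ_succ (Z.of_nat N - Z.of_nat i)).
    rewrite (odd_harmonicZ_succ (Z.of_nat N + Z.of_nat i + 2)).
    rewrite minus_IZR, !plus_IZR, <- !INR_IZR_INZ, S_INR.
    assert (HN := pos_INR N). assert (Hne := odd_neq_even i (S N)).
    rewrite S_INR in Hne.
    generalize (odd_harmonicZ (Z.of_nat N - Z.of_nat i))
      (odd_harmonicZ (Z.of_nat N + Z.of_nat i + 2)). intros u v.
    eq_in_R. field. repeat split; try lra.
    replace ((2 * (INR N + 1) + 1) ^ 2 - (2 * INR i + 2) ^ 2)
      with ((2 * (INR N + 1) + 1 - (2 * INR i + 2))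
            * (2 * (INR N + 1) + 1 + (2 * INR i + 2))) by ring.
    apply Rmult_integral_contrapositive; split; lra.
Qed.

(** The kernel is the sum of [1 / (o - e)] and [1 / (o + e)] divided by [2o].
    The even numbers do not include zero, and the missing term [e = 0] leaves
    the constant [- 1 / (2 o^2)]. *)
Lemma pole_column_sum (j N : nat) :
  sum_n (fun i => pole i j) N =
  - / (2 * (2 * INR j + 1) ^ 2)
  + (odd_harmonicZ (Z.of_nat j + Z.of_nat N + 2)
     - odd_harmonicZ (Z.of_nat j - Z.of_nat N - 1)) / (2 * (2 * INR j + 1)).
Proof.
  assert (Hj := pos_INR j).
  induction N as [|N IH].
  - rewrite sum_n_R0. unfold pole.
    replace (Z.of_nat j + Z.of_nat 0 + 2)%Z
      with (Z.of_nat j - Z.of_nat 0 - 1 + 1 + 1 + 1)%Z by lia.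
    rewrite !odd_harmonicZ_succ, !plus_IZR, !minus_IZR, <- !INR_IZR_INZ.
    simpl INR. assert (Hne := odd_neq_even 0 j). simpl INR in Hne.
    generalize (odd_harmonicZ (Z.of_nat j - Z.of_nat 0 - 1)). intros u.
    eq_in_R. field. repeat split; try lra.
    replace ((2 * INR j + 1) ^ 2 - 4)
      with ((2 * INR j + 1 - (2 * 0 + 2)) * (2 * INR j + 3)) by ring.
    apply Rmult_integral_contrapositive; split; lra.
  - rewrite sum_n_RS, IH. unfold pole.
    replace (Z.of_nat j - Z.of_nat N - 1)%Z
      with (Z.of_nat j - Z.of_nat (S N) - 1 + 1)%Z by lia.
    replace (Z.of_nat j + Z.of_nat (S N) + 2)%Z
      with (Z.of_nat j + Z.of_nat N + 2 + 1)%Z by lia.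
    rewrite (odd_harmonicZ_succ (Z.of_nat j - Z.of_nat (S N) - 1)).
    rewrite (odd_harmonicZ_succ (Z.of_nat j + Z.of_nat N + 2)).
    rewrite !minus_IZR, !plus_IZR, <- !INR_IZR_INZ, S_INR.
    assert (HN := pos_INR N). assert (Hne := odd_neq_even (S N) j).
    rewrite S_INR in Hne.
    generalize (odd_harmonicZ (Z.of_nat j - Z.of_nat (S N) - 1))
      (odd_harmonicZ (Z.of_nat j + Z.of_nat N + 2)). intros u v.
    eq_in_R. field. repeat split; try lra.
    replace ((2 * INR j + 1) ^ 2 - (2 * (INR N + 1) + 2) ^ 2)
      with ((2 * INR j + 1 - (2 * (INR N + 1) + 2))
            * (2 * INR j + 1 + (2 * (INR N + 1) + 2))) by ring.
    apply Rmult_integral_contrapositive; split; lra.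
Qed.

(** The two values of [odd_harmonicZ] differ by [e = 2i + 2] terms, none larger
    than the right-hand side, and the prefactor is [1 / (2e)]. *)
Lemma pole_row_sum_bound (i N : nat) : (i <= N)%nat ->
  Rabs (sum_n (fun j => pole i j) N) <= / (2 * (INR N - INR i) + 1).
Proof.
  intros Hle. rewrite pole_row_sum. assert (Hi := pos_INR i).
  assert (HiN := le_INR _ _ Hle).
  destruct (odd_harmonicZ_gap (Z.of_nat N - Z.of_nat i) (2 * Z.of_nat i + 2))
    as [H0 H1]; [lia|lia|].
  replace (Z.of_nat N - Z.of_nat i + (2 * Z.of_nat i + 2))%Z
    with (Z.of_nat N + Z.of_nat i + 2)%Z in * by ring.
  rewrite plus_IZR, mult_IZR, minus_IZR, <- !INR_IZR_INZ in H1.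
  set (b := 2 * (INR N - INR i) + 1) in *.
  assert (Hb : 0 < / b) by (apply Rinv_0_lt_compat; unfold b; lra).
  set (u := odd_harmonicZ (Z.of_nat N - Z.of_nat i)) in *.
  set (v := odd_harmonicZ (Z.of_nat N + Z.of_nat i + 2)) in *.
  replace ((u - v) / (4 * (INR i + 1))) with (- ((v - u) / (4 * (INR i + 1))))
    by (field; lra).
  rewrite Rabs_Ropp.
  rewrite Rabs_pos_eq by (apply Rdiv_le_0_compat; lra).
  apply Rle_div_l; [lra|]. eapply Rle_trans; [exact H1|].
  unfold Rdiv. rewrite Rmult_comm. apply Rmult_le_compat_l; lra.
Qed.

Lemma pole_column_sum_bound (j N : nat) : (j <= N)%nat ->
  Rabs (sum_n (fun i => pole i j) N + / (2 * (2 * INR j + 1) ^ 2))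
  <= / (2 * (INR N - INR j) + 1).
Proof.
  intros Hle. rewrite pole_column_sum. assert (Hj := pos_INR j).
  assert (HjN := le_INR _ _ Hle).
  rewrite <- (odd_harmonicZ_opp (Z.of_nat j - Z.of_nat N - 1)).
  destruct (odd_harmonicZ_gap (- (Z.of_nat j - Z.of_nat N - 1))
              (2 * Z.of_nat j + 1)) as [H0 H1]; [lia|lia|].
  replace (- (Z.of_nat j - Z.of_nat N - 1) + (2 * Z.of_nat j + 1))%Z
    with (Z.of_nat j + Z.of_nat N + 2)%Z in * by ring.
  rewrite plus_IZR, mult_IZR, opp_IZR, !minus_IZR, <- !INR_IZR_INZ in H1.
  set (g := odd_harmonicZ _ - odd_harmonicZ _) in *.
  replace (- / _ + _ + _) with (g / (2 * (2 * INR j + 1)))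
    by (field; lra).
  rewrite Rabs_pos_eq by (apply Rdiv_le_0_compat; lra).
  apply Rle_div_l; [lra|].
  eapply Rle_trans; [exact H1|].
  unfold Rdiv. rewrite Rmult_comm.
  apply Rmult_le_compat; [|lra| |lra].
  - apply Rlt_le, Rinv_0_lt_compat; lra.
  - apply Rinv_le_contravar; lra.
Qed.

(** The truncation errors are at most [1] and tend to zero for each fixed
    index, so they disappear against summable weights by [tannery_zero],
    applied to the truncated sums extended by zero. *)
Lemma is_lim_seq_weighted_sum (w : nat -> R) (r : nat -> nat -> R) :
  (forall n, 0 <= w n) -> ex_series w ->
  (forall i N, (i <= N)%nat -> Rabs (r i N) <= / (2 * (INR N - INR i) + 1)) ->
  is_lim_seq (fun N => sum_n (fun i => w i * r i N) N) 0.
Proof.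
  intros Hw Hex Hr.
  set (v := fun i N => if le_dec i N then w i * r i N else 0).
  assert (Hv : forall i N, Rabs (v i N) <= w i).
  { intros i N. unfold v. destruct (le_dec i N) as [H|H].
    - rewrite Rabs_mult, Rabs_pos_eq by apply Hw.
      rewrite <- (Rmult_1_r (w i)) at 2. apply Rmult_le_compat_l; [apply Hw|].
      eapply Rle_trans; [now apply Hr|]. apply le_INR in H.
      rewrite <- Rinv_1. apply Rinv_le_contravar; lra.
    - rewrite Rabs_R0. apply Hw. }
  refine (tannery_zero (V := R_NormedModule) v w
            (fun N => sum_n (fun i => w i * r i N) N) Hv Hex _ _).
  - intros i.
    assert (Hlim : is_lim_seq
              (fun N => w i * exp (- (1) * ln (INR N + 2))) (w i * 0)).
    { apply (is_lim_seq_scal_l _ _ 0). apply is_lim_seq_exp_neg_ln. lra. }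
    apply (is_lim_seq_incr_n _ (i + 1) 0).
    apply (is_lim_seq_le_le (fun N => - (w i * exp (- (1) * ln (INR N + 2))))
             _ (fun N => w i * exp (- (1) * ln (INR N + 2)))).
    + intros N. apply Rabs_le_between.
      unfold v. destruct (le_dec i (N + (i + 1))) as [H|H]; [|lia].
      rewrite Rabs_mult, Rabs_pos_eq by apply Hw.
      apply Rmult_le_compat_l; [apply Hw|].
      eapply Rle_trans; [now apply Hr|].
      assert (HN := pos_INR N).
      replace (- (1) * ln (INR N + 2)) with (- ln (INR N + 2)) by ring.
      rewrite exp_Ropp, exp_ln by lra. rewrite !plus_INR. simpl INR.
      apply Rinv_le_contravar; lra.
    + rewrite Rmult_0_r in Hlim.
      replace (Finite 0) with (Rbar_opp 0) by (simpl; f_equal; ring).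
      now apply -> is_lim_seq_opp.
    + now rewrite Rmult_0_r in Hlim.
  - intros N.
    assert (E : forall M, sum_n (fun i => v i N) (N + M)
                          = sum_n (fun i => w i * r i N) N).
    { intros M. induction M as [|M IH].
      - rewrite Nat.add_0_r. apply sum_n_ext_loc. intros i Hi. unfold v.
        destruct (le_dec i N); [reflexivity|contradiction].
      - rewrite Nat.add_succ_r, sum_n_RS, IH. unfold v.
        destruct (le_dec (S (N + M)) N); [lia|]. eq_in_R. ring. }
    change (is_lim_seq (sum_n (fun n => v n N))
              (sum_n (fun i => w i * r i N) N)).
    apply (is_lim_seq_incr_n _ N _).
    apply is_lim_seq_ext with (fun _ => sum_n (fun i => w i * r i N) N).
    + intros M. now rewrite (Nat.add_comm M N), E.
    + apply is_lim_seq_const.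
Qed.

Lemma geometric_convolution (x y : R) (p : nat) :
  (x - y) * sum_n (fun k => x ^ S k * y ^ (S p - k)) p
  = x * y * (x ^ S p - y ^ S p).
Proof.
  induction p as [|p IH].
  - rewrite sum_n_R0. simpl. ring.
  - rewrite sum_n_RS.
    rewrite (sum_n_ext_loc _ (fun k => y * (x ^ S k * y ^ (S p - k)))).
    2:{ intros k Hk. replace (S (S p) - k)%nat with (S (S p - k)) by lia.
        eq_in_R. simpl pow. ring. }
    rewrite sum_n_Rscal.
    replace (S (S p) - S p)%nat with 1%nat by lia.
    replace ((x - y) * (y * sum_n (fun k => x ^ S k * y ^ (S p - k)) p
                        + x ^ S (S p) * y ^ 1))
      with (y * ((x - y) * sum_n (fun k => x ^ S k * y ^ (S p - k)) p)
            + (x - y) * (x ^ S (S p) * y ^ 1)) by ring.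
    rewrite IH. simpl. ring.
Qed.

Definition even_inv_sq (n : nat) : R := / (2 * INR n + 2) ^ 2.
Definition odd_inv_sq (n : nat) : R := / (2 * INR n + 1) ^ 2.

Lemma odd_inv_sq_bounds (n : nat) : 0 < odd_inv_sq n <= 1.
Proof.
  unfold odd_inv_sq. assert (Hn := pos_INR n). split.
  - apply Rinv_0_lt_compat, pow_lt. lra.
  - rewrite <- Rinv_1. apply Rinv_le_contravar; nra.
Qed.

Lemma even_inv_sq_bounds (n : nat) : 0 < even_inv_sq n <= odd_inv_sq n.
Proof.
  unfold even_inv_sq, odd_inv_sq. assert (Hn := pos_INR n). split.
  - apply Rinv_0_lt_compat, pow_lt. lra.
  - apply Rinv_le_contravar; nra.
Qed.

Lemma ex_series_odd_inv_sq : ex_series odd_inv_sq.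
Proof.
  apply ex_series_bounded_sums with (3 / 2).
  { intros n. apply Rlt_le, odd_inv_sq_bounds. }
  assert (H : forall N, sum_n odd_inv_sq N <= 3 / 2 * (1 - / (2 * INR N + 3))).
  { assert (Hb : forall n, odd_inv_sq n <=
              3 / 2 * (/ (2 * INR n + 1) - / (2 * INR n + 3))).
    { intros n. unfold odd_inv_sq. assert (Hn := pos_INR n).
      replace (3 / 2 * (/ (2 * INR n + 1) - / (2 * INR n + 3)))
        with (/ ((2 * INR n + 1) * ((2 * INR n + 3) / 3))) by (field; lra).
      apply Rinv_le_contravar; nra. }
    intros N. induction N as [|N IH].
    - rewrite sum_n_R0. specialize (Hb 0%nat). simpl INR in *.
      replace (2 * 0 + 1) with 1 in Hb by ring. lra.
    - rewrite sum_n_RS. specialize (Hb (S N)).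
      rewrite S_INR in *.
      replace (2 * (INR N + 1) + 1) with (2 * INR N + 3) in Hb by ring. lra. }
  intros N. assert (HN := H N). assert (Hp := pos_INR N).
  assert (0 < / (2 * INR N + 3)) by (apply Rinv_0_lt_compat; lra). lra.
Qed.

Lemma ex_series_pow_le (w : nat -> R) (k : nat) :
  (forall n, 0 < w n <= odd_inv_sq n) -> ex_series (fun n => w n ^ S k).
Proof.
  intros Hw.
  apply (ex_series_le (K := R_AbsRing) (V := R_CompleteNormedModule)
           (fun n => w n ^ S k) odd_inv_sq); [|exact ex_series_odd_inv_sq].
  intros n. change (Rabs (w n ^ S k) <= odd_inv_sq n).
  assert (H := Hw n). assert (H1 := odd_inv_sq_bounds n).
  rewrite Rabs_pos_eq by (apply pow_le; lra).
  apply Rle_trans with (w n); [|lra].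
  assert (w n ^ k <= 1) by (rewrite <- (pow1 k); apply pow_incr; lra).
  simpl. nra.
Qed.

Lemma is_lim_seq_sum_n (u : nat -> nat -> R) (l : nat -> R) :
  (forall k, is_lim_seq (u k) (l k)) ->
  forall n, is_lim_seq (fun N => sum_n (fun k => u k N) n) (sum_n l n).
Proof.
  intros H n. induction n as [|n IH].
  - rewrite sum_n_R0. apply is_lim_seq_ext with (2 := H 0%nat).
    intros N. now rewrite sum_n_R0.
  - rewrite sum_n_RS.
    apply is_lim_seq_ext with (fun N => sum_n (fun k => u k N) n + u (S n) N).
    + intros N. now rewrite sum_n_RS.
    + now apply is_lim_seq_plus'.
Qed.

(** With [x = e^(-2)] and [y = o^(-2)], the factor [x y / (x - y)] of the
    geometric sum is [1 / (1/y - 1/x) = 1 / (o^2 - e^2)]. *)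
Lemma pole_partial_fraction (i j p : nat) :
  sum_n (fun k => even_inv_sq i ^ S k * odd_inv_sq j ^ (S p - k)) p
  = pole i j * (even_inv_sq i ^ S p - odd_inv_sq j ^ S p).
Proof.
  assert (Hi := pos_INR i). assert (Hj := pos_INR j).
  assert (Hne := odd_neq_even i j).
  assert (Hd : (2 * INR j + 1) ^ 2 - (2 * INR i + 2) ^ 2 <> 0).
  { replace ((2 * INR j + 1) ^ 2 - (2 * INR i + 2) ^ 2)
      with ((2 * INR j + 1 - (2 * INR i + 2))
            * (2 * INR j + 1 + (2 * INR i + 2))) by ring.
    apply Rmult_integral_contrapositive; split; lra. }
  assert (G := geometric_convolution (even_inv_sq i) (odd_inv_sq j) p).
  set (s := sum_n _ p) in *.
  set (x := even_inv_sq i) in *. set (y := odd_inv_sq j) in *.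
  assert (E : x - y = x * y * / pole i j).
  { unfold x, y, even_inv_sq, odd_inv_sq, pole. rewrite Rinv_inv. field.
    split; lra. }
  assert (Hx : x <> 0) by (apply Rgt_not_eq, even_inv_sq_bounds).
  assert (Hy : y <> 0) by (apply Rgt_not_eq, odd_inv_sq_bounds).
  assert (Hp : pole i j <> 0) by (apply Rinv_neq_0_compat, Hd).
  rewrite E in G.
  apply (Rmult_eq_reg_l (x * y * / pole i j)).
  - rewrite G. field. exact Hp.
  - repeat apply Rmult_integral_contrapositive_currified; auto.
    now apply Rinv_neq_0_compat.
Qed.

(** On the square truncation the two halves of
    [(e^(-2m) - o^(-2m)) / (o^2 - e^2)] are summed in opposite orders; what
    survives in the limit is the constant [- 1 / (2 o^2)] of the column
    sums. *)
Lemma even_odd_convolution (p : nat) :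
  sum_n (fun k => Series (fun n => even_inv_sq n ^ S k)
                  * Series (fun n => odd_inv_sq n ^ (S p - k))) p
  = / 2 * Series (fun n => odd_inv_sq n ^ S (S p)).
Proof.
  assert (Heven : forall k, is_series (fun n => even_inv_sq n ^ S k)
                    (Series (fun n => even_inv_sq n ^ S k))).
  { intros k. apply Series_correct, ex_series_pow_le, even_inv_sq_bounds. }
  assert (Hodd : forall k, is_series (fun n => odd_inv_sq n ^ S k)
                    (Series (fun n => odd_inv_sq n ^ S k))).
  { intros k. apply Series_correct, ex_series_pow_le. intros n.
    assert (H := odd_inv_sq_bounds n). lra. }
  set (x := even_inv_sq) in *. set (y := odd_inv_sq) in *.
  (* The last sum is added and subtracted so that the bracket in the second
     one tends to zero. *)
  assert (Hsplit : forall N,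
    sum_n (fun k => sum_n (fun n => x n ^ S k) N
                    * sum_n (fun n => y n ^ S (p - k)) N) p
    = sum_n (fun i => x i ^ S p * sum_n (fun j => pole i j) N) N
      - sum_n (fun j => y j ^ S p *
                 (sum_n (fun i => pole i j) N + / (2 * (2 * INR j + 1) ^ 2))) N
      + / 2 * sum_n (fun j => y j ^ S (S p)) N).
  { intros N.
    transitivity (sum_n (fun i => sum_n (fun j =>
                    pole i j * (x i ^ S p - y j ^ S p)) N) N).
    - transitivity (sum_n (fun k => sum_n (fun i => sum_n (fun j =>
                      x i ^ S k * y j ^ (S p - k)) N) N) p).
      + apply sum_n_ext_loc. intros k Hk.
        replace (S p - k)%nat with (S (p - k)) by lia.
        rewrite Rmult_comm, <- sum_n_Rscal. apply sum_n_ext. intros i.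
        rewrite Rmult_comm, <- sum_n_Rscal. reflexivity.
      + rewrite sum_n_switch. apply sum_n_ext. intros i.
        rewrite sum_n_switch. apply sum_n_ext. intros j.
        apply pole_partial_fraction.
    - transitivity (sum_n (fun i => sum_n (fun j => x i ^ S p * pole i j) N) N
                    - sum_n (fun i => sum_n (fun j => y j ^ S p * pole i j) N) N).
      + assert (Hminus : forall (a b : nat -> R) n,
                  sum_n (fun k => a k - b k) n = sum_n a n - sum_n b n).
        { intros a b n. induction n as [|n IH]; [now rewrite !sum_n_R0|].
          rewrite !sum_n_RS, IH. eq_in_R. ring. }
        rewrite <- Hminus. apply sum_n_ext. intros i.
        rewrite <- Hminus. apply sum_n_ext. intros j.
        change (pole i j * (x i ^ S p - y j ^ S p)
                = x i ^ S p * pole i j - y j ^ S p * pole i j). ring.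
      + rewrite (sum_n_switch (fun i j => y j ^ S p * pole i j)).
        rewrite (sum_n_ext _ (fun i => x i ^ S p * sum_n (fun j => pole i j) N))
          by (intros i; apply sum_n_Rscal).
        rewrite (sum_n_ext (fun j => sum_n (fun i => y j ^ S p * pole i j) N)
                   (fun j => y j ^ S p * sum_n (fun i => pole i j) N))
          by (intros j; apply sum_n_Rscal).
        assert (Hplus : forall (a b c : nat -> R) n,
                  (forall k, c k = a k + / 2 * b k) ->
                  sum_n a n = sum_n c n - / 2 * sum_n b n).
        { intros a b c n Hc. induction n as [|n IH].
          - rewrite !sum_n_R0, Hc. eq_in_R. ring.
          - rewrite !sum_n_RS, IH, Hc. eq_in_R. ring. }
        rewrite (Hplus (fun j => y j ^ S p * sum_n (fun i => pole i j) N)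
                   (fun j => y j ^ S (S p))
                   (fun j => y j ^ S p *
                 (sum_n (fun i => pole i j) N + / (2 * (2 * INR j + 1) ^ 2)))).
        * eq_in_R. ring.
        * intros j. change (y j ^ S (S p)) with (y j * y j ^ S p).
          replace (/ (2 * (2 * INR j + 1) ^ 2)) with (/ 2 * y j); [ring|].
          unfold y, odd_inv_sq. assert (Hj := pos_INR j). field. lra. }
  assert (H1 : is_lim_seq (fun N =>
            sum_n (fun k => sum_n (fun n => x n ^ S k) N
                            * sum_n (fun n => y n ^ S (p - k)) N) p)
            (sum_n (fun k => Series (fun n => x n ^ S k)
                             * Series (fun n => y n ^ S (p - k))) p)).
  { apply (is_lim_seq_sum_n (fun k N => sum_n (fun n => x n ^ S k) N
                            * sum_n (fun n => y n ^ S (p - k)) N)).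
    intros k. apply is_lim_seq_mult'; [apply Heven | apply Hodd]. }
  assert (H2 : is_lim_seq (fun N =>
            sum_n (fun k => sum_n (fun n => x n ^ S k) N
                            * sum_n (fun n => y n ^ S (p - k)) N) p)
            (0 - 0 + / 2 * Series (fun n => y n ^ S (S p)))).
  { eapply is_lim_seq_ext; [intros N; symmetry; apply Hsplit|].
    apply is_lim_seq_plus'.
    - apply is_lim_seq_minus'.
      + apply (is_lim_seq_weighted_sum (fun i => x i ^ S p)
                 (fun i N => sum_n (fun j => pole i j) N)).
        * intros n. apply pow_le, Rlt_le, even_inv_sq_bounds.
        * eexists; apply Heven.
        * apply pole_row_sum_bound.
      + apply (is_lim_seq_weighted_sum (fun j => y j ^ S p)
                 (fun j N => sum_n (fun i => pole i j) N
                             + / (2 * (2 * INR j + 1) ^ 2))).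
        * intros n. apply pow_le, Rlt_le, odd_inv_sq_bounds.
        * eexists; apply Hodd.
        * apply pole_column_sum_bound.
    - apply (is_lim_seq_scal_l _ (/ 2) (Finite _)). apply Hodd. }
  apply is_lim_seq_unique in H1. apply is_lim_seq_unique in H2.
  rewrite H1 in H2. apply Rbar_finite_eq in H2.
  rewrite (sum_n_ext_loc _ (fun k => Series (fun n => x n ^ S k)
                                     * Series (fun n => y n ^ S (p - k)))).
  - rewrite H2. eq_in_R. ring.
  - intros k Hk. now replace (S p - k)%nat with (S (p - k)) by lia.
Qed.

(** * The convolution identity *)

Lemma lambda_even (j : nat) :
  dirichlet_lambda (RtoC (2 * INR (S j)))
  = RtoC (Series (fun n => odd_inv_sq n ^ S j)).
Proof.
  apply CSeries_unique.
  apply (is_series_ext (V := C_NormedModule))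
    with (fun n => RtoC (odd_inv_sq n ^ S j)).
  - intros n. assert (Hn := pos_INR n).
    rewrite Rcpow_RtoC.
    replace (2 * INR (S j)) with (INR (2 * S j))
      by (rewrite mult_INR; reflexivity).
    change (exp (INR (2 * S j) * ln (2 * INR n + 1)))
      with (Rpower (2 * INR n + 1) (INR (2 * S j))).
    rewrite Rpower_pow by lra. unfold odd_inv_sq.
    rewrite pow_inv, <- pow_mult. apply RtoC_inv, pow_nonzero. lra.
  - apply is_series_RtoC, Series_correct, ex_series_pow_le. intros n.
    assert (H := odd_inv_sq_bounds n). lra.
Qed.

Lemma zeta_even (zeta : C -> C) (k : nat) : is_riemann_zeta zeta ->
  (/ (RtoC 2 ^ (2 * S k)) * zeta (RtoC (2 * INR (S k))))%C
  = RtoC (Series (fun n => even_inv_sq n ^ S k)).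
Proof.
  intros Hz. assert (Hk := pos_INR k).
  destruct (zeta_real_series zeta (2 * INR (S k)) Hz) as (Z & HZ & EZ).
  { rewrite S_INR. lra. }
  assert (H2 : 2 ^ (2 * S k) <> 0) by (apply pow_nonzero; lra).
  rewrite EZ, <- RtoC_pow, <- RtoC_inv, <- RtoC_mult by exact H2.
  f_equal. symmetry. apply is_series_unique.
  apply is_series_Rext with (2 := is_series_Rscal (/ 2 ^ (2 * S k)) _ _ HZ).
  intros n. assert (Hn := pos_INR n).
  replace (- (2 * INR (S k)) * ln (INR n + 1))
    with (- (INR (2 * S k) * ln (INR n + 1)))
    by (rewrite mult_INR; simpl (INR 2); ring).
  rewrite exp_Ropp.
  change (exp (INR (2 * S k) * ln (INR n + 1)))
    with (Rpower (INR n + 1) (INR (2 * S k))).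
  rewrite Rpower_pow by lra. unfold even_inv_sq.
  rewrite pow_inv, <- pow_mult.
  replace (2 * INR n + 2) with (2 * (INR n + 1)) by ring.
  rewrite Rpow_mult_distr. symmetry. apply Rinv_mult.
Qed.

Theorem theorem5p2 (zeta : C -> C) (Hzeta : is_riemann_zeta zeta)
    (m : nat) (Hm : (0 < m)%nat) :
  sum_n (fun k : nat =>
           (/ (RtoC 2 ^ (2 * k))
            * zeta (RtoC (2 * INR k))
            * dirichlet_lambda (RtoC (2 * INR m - 2 * INR k + 2)))%C) m
  = RtoC 0.
Proof.
  destruct m as [|p]; [lia|]. clear Hm.
  set (t := fun k => match k with
              | O => - / 2 * Series (fun n => odd_inv_sq n ^ S (S p))
              | S k => Series (fun n => even_inv_sq n ^ S k)
                       * Series (fun n => odd_inv_sq n ^ (S p - k))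
              end).
  rewrite (sum_n_ext_loc _ (fun k => RtoC (t k))).
  2:{ intros k Hk.
      replace (2 * INR (S p) - 2 * INR k + 2) with (2 * INR (S (S p - k)))
        by (rewrite (S_INR (S p - k)), minus_INR by exact Hk; ring).
      rewrite lambda_even.
      destruct k as [|k].
      - rewrite Nat.sub_0_r. change (INR 0) with 0. rewrite Rmult_0_r.
        rewrite (zeta_at_0 zeta Hzeta). unfold t.
        rewrite RtoC_mult. change (RtoC 2 ^ (2 * 0))%C with (RtoC 1).
        replace (- (1 / 2)) with (- / 2) by field.
        rewrite <- RtoC_inv, <- RtoC_mult by lra. now rewrite Rinv_1, Rmult_1_l.
      - rewrite (zeta_even zeta k Hzeta). unfold t. rewrite RtoC_mult.
        now replace (S (S p - S k)) with (S p - k)%nat by lia. }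
  assert (E : forall N, sum_n (G := C_AbelianMonoid) (fun k => RtoC (t k)) N
                        = RtoC (sum_n t N)).
  { intros N. induction N as [|N IH]; [now rewrite !sum_O|].
    rewrite !sum_Sn, IH. symmetry. apply RtoC_plus. }
  assert (Hsplit : forall N, sum_n t (S N) = t 0%nat + sum_n (fun k => t (S k)) N).
  { intros N. induction N as [|N IH].
    - rewrite sum_n_RS, !sum_n_R0. reflexivity.
    - rewrite sum_n_RS, IH, (sum_n_RS (fun k => t (S k))). eq_in_R. ring. }
  etransitivity; [apply (E (S p))|]. f_equal.
  rewrite Hsplit. unfold t. rewrite even_odd_convolution. eq_in_R. ring.
Qed.
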